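(* Let $X$ be a complete and proper CAT(0) space, and fix a curtain model $X_D=(X,D)$ of $X$. Let $g\in \mathrm{Isom}(X)$. If $g$ is parabolic as an isometry of the hyperbolic space $X_D$, then $g$ is strictly parabolic as an isometry of $X$.
   Context: **Curtain model.** Let $X$ be a CAT(0) space with metric $d$. Let $\alpha: I\to X$ be a geodesic (isometric embedding of an interval $I\subseteq\mathbb{R}$; points of $I$ are identified with their images) and let $\pi_\alpha$ be the closest point projection to $\alpha$. For $r$ with $[r-1/2,r+1/2]$ in the interior of $I$, the curtain dual to $\alpha$ at $r$ is $h=h_{\alpha,r}=\pi_\alpha^{-1}([r-1/2,r+1/2])$; its half spaces are $h^-=\pi_\alpha^{-1}((-\infty,r-1/2))$ and $h^+=\pi_\alpha^{-1}((r+1/2,\infty))$ (intersected with $I$). A curtain $h$ separates $A,B\subseteq X$ if $A\subseteq h^-$ and $B\subseteq h^+$ or vice versa. A chain is a set (sequence) of curtains $\{h_i\}$ such that $h_i$ separates $h_{i-1}$ from $h_{i+1}$ for all $i$; a chain separates $A$ from $B$ if each $h_i$ does. For $L\in\mathbb{N}$, disjoint curtains $h,h'$ are $L$-separated if every chain all of whose curtains meet both $h$ and $h'$ has cardinality at most $L$. An $L$-chain is a chain in which each pair of curtains is $L$-separated. Define $d_L(x,x)=0$ and, for $x\ne y$, $d_L(x,y)=1+\max\{|c| : c \text{ is an } L\text{-chain separating } x \text{ from } y\}$; this is a metric on $X$. Fix a sequence $\lambda_L\in(0,1)$, $L\ge 1$, with $\sum_{L\ge1}\lambda_L=1$ and $\sum_{L\ge1}L^2\lambda_L<\infty$.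 The (associated) curtain model is $X_D=(X,D)$ with $D(x,y)=\sum_{L=1}^\infty\lambda_L d_L(x,y)$. It is a Gromov hyperbolic space (four-point condition), and every isometry of $X$ is an isometry of $X_D$. **Isometries.** For an isometry $g$ of a metric space $(Y,\rho)$, the translation length is $\tau(g)=\lim_{n\to\infty}\rho(x,g^nx)/n$ (independent of $x$), and $\mathrm{Min}(g)=\{x: \rho(x,gx)=\tau(g)\}$. An isometry $g$ of a CAT(0) space is parabolic if $\mathrm{Min}(g)=\varnothing$, and strictly parabolic if it is parabolic and $\tau(g)=0$. An isometry of a Gromov hyperbolic space is parabolic if its translation length is $0$ and one (equivalently every) orbit of $\langle g\rangle$ is unbounded; in $X_D$ this is measured with the metric $D$. *)

(* Defs.v *)
From HB Require Import structures.
From mathcomp Require Import all_boot all_order all_algebra.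
From mathcomp Require Import all_classical all_reals all_analysis.

Set Implicit Arguments.
Unset Strict Implicit.
Unset Printing Implicit Defensive.

Import Order.TTheory GRing.Theory Num.Theory.
Import numFieldNormedType.Exports.

Local Open Scope classical_set_scope.
Local Open Scope ring_scope.

Section MetricSpaces.
Context {R : realType}.

(* The library's completeType is only available for pointed types. *)
Definition complete_space (X : metricType R) : Prop :=
  forall F : set_system X, ProperFilter F -> cauchy F -> exists l : X, F --> l.

Definition proper_space (X : metricType R) : Prop :=
  forall (x : X) (r : R), compact [set y | mdist x y <= r].

Context {X : metricType R}.

(* Only the values of a on I are relevant. *)
Definition geodesic (I : set R) (a : R -> X) : Prop :=
  is_interval I /\
  forall s t, I s -> I t -> mdist (a s) (a t) = `|s - t|.

Definition geodesic_segment (p q : X) (a : R -> X) : Prop :=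
  [/\ geodesic `[0, mdist p q]%classic a, a 0 = p & a (mdist p q) = q].

(* The library's norm on R * R is the sup norm, hence this definition. *)
Definition euclid (u v : R * R) : R :=
  Num.sqrt ((u.1 - v.1) ^+ 2 + (u.2 - v.2) ^+ 2).

Definition on_euclid_segment (p q x : R * R) : Prop :=
  euclid p x + euclid x q = euclid p q.

End MetricSpaces.

(* Comparison triangles in the Euclidean plane.  Two points on distinct sides
   of a geodesic triangle lie on two sides sharing a vertex, called p below; the
   case of two points on the same side is the case q = r, a = b. *)
Definition CAT0 {R : realType} (X : metricType R) : Prop :=
  (forall p q : X, exists a, geodesic_segment p q a) /\
  forall (p q r : X) (a b : R -> X) (p' q' r' x' y' : R * R) (s t : R),
    geodesic_segment p q a -> geodesic_segment p r b ->
    euclid p' q' = mdist p q ->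
    euclid p' r' = mdist p r ->
    euclid q' r' = mdist q r ->
    0 <= s <= mdist p q -> on_euclid_segment p' q' x' -> euclid p' x' = s ->
    0 <= t <= mdist p r -> on_euclid_segment p' r' y' -> euclid p' y' = t ->
    mdist (a s) (b t) <= euclid x' y'.

Record curtain {R : realType} (X : metricType R) := Curtain {
  curtain_dom : set R;
  curtain_geo : R -> X;
  curtain_pole : R;
  curtain_geoP : geodesic curtain_dom curtain_geo;
  curtain_poleP :
    `[curtain_pole - 2^-1, curtain_pole + 2^-1]%classic `<=` curtain_dom°
}.

Section Curtains.
Context {R : realType} {X : metricType R}.

(* a t is a closest point to x on the geodesic a : I -> X.  When X is CAT(0) it
   is unique if it exists, and it exists if X is complete and I is closed. *)
Definition is_proj (I : set R) (a : R -> X) (x : X) (t : R) : Prop :=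
  I t /\ forall s, I s -> mdist x (a t) <= mdist x (a s).

Definition proj_preimage (I : set R) (a : R -> X) (J : set R) : set X :=
  [set x | exists2 t, is_proj I a x t & J t].

Definition curtain_set (h : curtain X) : set X :=
  proj_preimage (curtain_dom h) (curtain_geo h)
    `[curtain_pole h - 2^-1, curtain_pole h + 2^-1]%classic.

Definition halfspace_minus (h : curtain X) : set X :=
  proj_preimage (curtain_dom h) (curtain_geo h)
    `]-oo, curtain_pole h - 2^-1[%classic.

Definition halfspace_plus (h : curtain X) : set X :=
  proj_preimage (curtain_dom h) (curtain_geo h)
    `]curtain_pole h + 2^-1, +oo[%classic.

Definition separates (h : curtain X) (A B : set X) : Prop :=
  (A `<=` halfspace_minus h /\ B `<=` halfspace_plus h) \/
  (A `<=` halfspace_plus h /\ B `<=` halfspace_minus h).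

(* A chain of cardinality n.  Its members are pairwise distinct as subsets of X
   (the same subset may be dual to several geodesics), so that n counts them. *)
Definition chain (n : nat) (c : 'I_n -> curtain X) : Prop :=
  injective (fun i => curtain_set (c i)) /\
  forall i j k : 'I_n, j = i.+1 :> nat -> k = j.+1 :> nat ->
    separates (c j) (curtain_set (c i)) (curtain_set (c k)).

Definition chain_separates (n : nat) (c : 'I_n -> curtain X) (A B : set X) :
  Prop := forall i, separates (c i) A B.

Definition meets (h k : curtain X) : Prop :=
  curtain_set h `&` curtain_set k !=set0.

(* An infinite chain contains finite chains of every cardinality, so finite
   chains suffice here. *)
Definition L_separated (L : nat) (h h' : curtain X) : Prop :=
  curtain_set h `&` curtain_set h' = set0 /\
  forall (n : nat) (c : 'I_n -> curtain X), chain c ->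
    (forall i, meets (c i) h /\ meets (c i) h') -> (n <= L)%N.

Definition L_chain (L n : nat) (c : 'I_n -> curtain X) : Prop :=
  chain c /\ forall i j : 'I_n, i != j -> L_separated L (c i) (c j).

Definition L_chain_cards (L : nat) (x y : X) : set nat :=
  [set n | exists c : 'I_n -> curtain X,
      L_chain L c /\ chain_separates c [set x] [set y]].

(* L_chain_cards L x y contains 0 and, in a CAT(0) space, is bounded by
   mdist x y; hence the supremum is a maximum. *)
Definition L_dist (L : nat) (x y : X) : R :=
  if x == y then 0 else 1 + sup [set n%:R | n in L_chain_cards L x y].

Definition curtain_weights (lambda : nat -> R) : Prop :=
  [/\ forall L, (0 < L)%N -> 0 < lambda L < 1,
      \sum_(1 <= L < n) lambda L @[n --> \oo] --> (1 : R) &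
      cvg (\sum_(1 <= L < n) L%:R ^+ 2 * lambda L @[n --> \oo])].

Definition curtain_model_dist (lambda : nat -> R) (x y : X) : R :=
  limn (fun n => \sum_(1 <= L < n) lambda L * L_dist L x y).

End Curtains.

Section Isometries.
Context {R : realType} {Y : Type} (rho : Y -> Y -> R).
Implicit Type g : Y -> Y.

Definition is_isometry g : Prop :=
  bijective g /\ forall x y, rho (g x) (g y) = rho x y.

Definition is_translation_length g (tau : R) : Prop :=
  forall x, rho x (iter n g x) / n%:R @[n --> \oo] --> tau.

Definition Min g : set Y :=
  [set x | is_translation_length g (rho x (g x))].

Definition parabolic g : Prop := Min g = set0.

Definition strictly_parabolic g : Prop :=
  parabolic g /\ is_translation_length g 0.

(* The orbit of x under the cyclic group generated by a bijection g; the second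
   disjunct gives the negative powers of g. *)
Definition cyclic_orbit g (x : Y) : set Y :=
  [set y | exists n, y = iter n g x \/ iter n g y = x].

Definition metric_bounded (A : set Y) : Prop :=
  exists M : R, forall x y, A x -> A y -> rho x y <= M.

Definition hyperbolic_parabolic g : Prop :=
  is_translation_length g 0 /\
  exists x, ~ metric_bounded (cyclic_orbit g x).

End Isometries.

(* Main.v *)
Require Import Defs.
From mathcomp Require Import all_boot all_order all_algebra.
From mathcomp Require Import all_classical all_reals all_analysis.
From mathcomp Require Import ring lra zify.

Set Implicit Arguments.
Unset Strict Implicit.
Unset Printing Implicit Defensive.

Import Order.TTheory GRing.Theory Num.Theory.
Import numFieldNormedType.Exports.

Local Open Scope classical_set_scope.
Local Open Scope ring_scope.

(** A curtain h is the band of points whose projection to a geodesic falls into an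
    interval of length one.  Its signed coordinate S, with h = {|S| <= 1/2}, is
    1-Lipschitz, and h, {S <= 1/2} and {S >= -1/2} are connected; these properties
    order disjoint curtains and detect their intersections.  Write f for a
    power of g, L for a separation constant and x for a base point, and let tau be
    the translation length of g on X, so that d(x, g^n x) = tau n + o(n).

    Everything rests on a dichotomy for tau > 0: either d_L(x, g^n x) is at most
    A L + B for all L >= 1 and all n, with A and B independent of L and n, or some
    power of g skewers a pair of L-separated curtains.  In the first case the
    orbit is bounded for D, because the weights have a finite second moment
    ([model_orbit_bounded]).  In the second case the translates of one curtain form
    L-chains of linear length along the orbit, so that g has positive translation
    length for D ([skewers_L_chain], [skewers_translation_length]).  Neither is
    possible if g is parabolic for D, whence tau = 0.  A fixed point of g in X
    would also make the orbits bounded for D, since d_L <= 1 + d.  Hence g has no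
    fixed point, and as tau = 0 this says that Min(g) is empty.

    For the dichotomy, let a long L-chain separate x from f x, and order its
    curtains from x to f x.  If the inverse image of x and the point f (f x) lie on
    the expected sides of the middle curtains h_i, then the image of some h_i is
    disjoint from a later curtain h_b: otherwise L + 1 images would meet two
    L-separated curtains.  Being disjoint from h_b, this image lies beyond it, which
    is skewering ([exists_skewers]).

    The remaining point is that the orbit does not backtrack
    ([no_backtracking]).  If g^N x and g^(-N) x both lay beyond many of the curtains
    seen from x, then the geodesics from x to these two points would stay within
    about L of each other for a long time, because two geodesics crossing the same
    L-separated curtains are close in between ([bottleneck]).  As tau > 0, the orbit
    points g^k x and g^(-k) x are within o(k) of these geodesics
    ([sublinear_tracking]), so they would be within o(k) + O(L) of each other.  For
    k a large multiple of L this contradicts d(g^k x, g^(-k) x) >= 2 tau k. *)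

(** * Comparison with Euclidean triangles *)

Section Comparison.
Context {R : realType}.

Lemma sqrt_eq_sqr (u v : R) : 0 <= v -> u = v ^+ 2 -> Num.sqrt u = v.
Proof. by move=> v0 ->; rewrite sqrtr_sqr ger0_norm. Qed.

Lemma exists_comparison_triangle (A B C : R) :
  0 <= A -> 0 <= B -> 0 <= C -> A <= B + C -> B <= A + C -> C <= A + B ->
  exists x y : R, [/\ x ^+ 2 + y ^+ 2 = B ^+ 2,
    (A - x) ^+ 2 + y ^+ 2 = C ^+ 2 & 2 * A * x = A ^+ 2 + B ^+ 2 - C ^+ 2].
Proof.
move=> A0 B0 C0 ABC BAC CAB.
have [A00|An0] := eqVneq A 0.
  have BC : B = C by apply/le_anti/andP; split; lra.
  by exists B, 0; split; rewrite ?A00 BC; ring.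
have Ap : 0 < A by rewrite lt_def An0.
pose x := (A ^+ 2 + B ^+ 2 - C ^+ 2) / (2 * A).
have xE : 2 * A * x = A ^+ 2 + B ^+ 2 - C ^+ 2 by rewrite /x; field.
have yge : 0 <= B ^+ 2 - x ^+ 2.
  have xB : x <= B by rewrite /x ler_pdivrMr ?mulr_gt0//; nra.
  have Bx : - B <= x by rewrite /x ler_pdivlMr ?mulr_gt0//; nra.
  nra.
exists x, (Num.sqrt (B ^+ 2 - x ^+ 2)); rewrite sqr_sqrtr//; split => //; first ring.
rewrite sqrrB.
have -> : A * x *+ 2 = 2 * A * x by ring.
rewrite xE; ring.
Qed.

Context {X : metricType R}.
Implicit Types p q r x y z : X.

Lemma mdist_triangle_l y x z : mdist x y <= mdist z x + mdist z y.
Proof. by rewrite (metric_sym z x) metric_triangle. Qed.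

Lemma mdist_triangle_r y x z : mdist x y <= mdist x z + mdist y z.
Proof. by rewrite (metric_sym y z) metric_triangle. Qed.

Lemma segment_mdist p q (a : R -> X) s t : geodesic_segment p q a ->
  0 <= s <= mdist p q -> 0 <= t <= mdist p q -> mdist (a s) (a t) = `|s - t|.
Proof. by move=> [[_ aE] _ _] hs ht; apply: aE; rewrite /= in_itv. Qed.

Lemma segment_mdistl p q (a : R -> X) s : geodesic_segment p q a ->
  0 <= s <= mdist p q -> mdist p (a s) = s.
Proof.
move=> ga hs; have [_ <- _] := ga; rewrite (segment_mdist ga)//.
  by rewrite sub0r normrN ger0_norm; case/andP: hs.
by rewrite lexx mdist_ge0.
Qed.

Lemma segment_mdistr p q (a : R -> X) s : geodesic_segment p q a ->
  0 <= s <= mdist p q -> mdist (a s) q = mdist p q - s.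
Proof.
move=> ga hs; have [_ _ {1}<-] := ga; rewrite (segment_mdist ga)//.
  by rewrite distrC ger0_norm; case/andP: hs => //; rewrite subr_ge0.
by rewrite lexx mdist_ge0.
Qed.

Lemma segment_prefix p q (a : R -> X) s : geodesic_segment p q a ->
  0 <= s <= mdist p q -> geodesic_segment p (a s) a.
Proof.
move=> ga hs; have E := segment_mdistl ga hs.
split; rewrite ?E //; last by case: ga.
split; first exact: interval_is_interval.
move=> u v /=; rewrite !in_itv/= => hu hv; apply: (segment_mdist ga).
  by case/andP: hu hs => -> /= h /andP[_ /(le_trans h)].
by case/andP: hv hs => -> /= h /andP[_ /(le_trans h)].
Qed.

Hypothesis X_CAT0 : CAT0 X.

(** The distance from a point to a geodesic is at most the distance in the
    comparison triangle, computed there by Stewart's theorem. *)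
Lemma CAT0_stewart p q r (a : R -> X) s : geodesic_segment p q a ->
  0 <= s <= mdist p q ->
  mdist p q * mdist r (a s) ^+ 2 <= (mdist p q - s) * mdist r p ^+ 2 +
    s * mdist r q ^+ 2 - s * (mdist p q - s) * mdist p q.
Proof.
move=> ga hs; have [b gb] := X_CAT0.1 p r.
have [[A0 B0] C0] := (mdist_ge0 p q, mdist_ge0 p r, mdist_ge0 q r).
have T1 : mdist p q <= mdist p r + mdist q r by exact: mdist_triangle_r.
have T2 : mdist p r <= mdist p q + mdist q r by exact: metric_triangle.
have T3 : mdist q r <= mdist p q + mdist p r by exact: mdist_triangle_l.
have [x [y [E1 E2 E3]]] := exists_comparison_triangle A0 B0 C0 T1 T2 T3.
have /andP[s0 sA] := hs.
have := X_CAT0.2 p q r a b (0, 0) (mdist p q, 0) (x, y) (s, 0) (x, y) s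
  (mdist p r) ga gb.
rewrite /on_euclid_segment /euclid /=.
have -> : Num.sqrt ((0 - mdist p q) ^+ 2 + (0 - 0) ^+ 2) = mdist p q.
  by apply: sqrt_eq_sqr => //; ring.
have -> : Num.sqrt ((0 - x) ^+ 2 + (0 - y) ^+ 2) = mdist p r.
  by apply: sqrt_eq_sqr => //; rewrite -E1; ring.
have -> : Num.sqrt ((mdist p q - x) ^+ 2 + (0 - y) ^+ 2) = mdist q r.
  by apply: sqrt_eq_sqr => //; rewrite -E2; ring.
have -> : Num.sqrt ((0 - s) ^+ 2 + (0 - 0) ^+ 2) = s.
  by apply: sqrt_eq_sqr => //; ring.
have -> : Num.sqrt ((s - mdist p q) ^+ 2 + (0 - 0) ^+ 2) = mdist p q - s.
  by apply: sqrt_eq_sqr; [lra | ring].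
have -> : Num.sqrt ((x - x) ^+ 2 + (y - y) ^+ 2) = 0.
  by apply: sqrt_eq_sqr => //; ring.
rewrite lexx B0 addr0.
move=> /(_ erefl erefl erefl hs (subrKC _ _) erefl isT erefl erefl).
have [_ _ ->] := gb => h.
rewrite (metric_sym r (a s)) (metric_sym r p) (metric_sym r q).
have : mdist (a s) r ^+ 2 <= (s - x) ^+ 2 + y ^+ 2.
  rewrite -(@sqr_sqrtr _ ((s - x) ^+ 2 + y ^+ 2)) ?addr_ge0 ?sqr_ge0//.
  rewrite lerXn2r ?nnegrE ?sqrtr_ge0 ?mdist_ge0//.
  by move: h; rewrite sub0r sqrrN.
move=> /(ler_wpM2l A0) /le_trans; apply.
have -> : mdist p q * ((s - x) ^+ 2 + y ^+ 2) =
  mdist p q * s ^+ 2 - s * (2 * mdist p q * x) + mdist p q * (x ^+ 2 + y ^+ 2).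
  by ring.
rewrite E1 E3 le_eqVlt; apply/orP; left; apply/eqP; ring.
Qed.

(** In the comparison triangle the two points are the images of its vertices under
    a homothety. *)
Lemma CAT0_fan p q r (a b : R -> X) l : geodesic_segment p q a ->
  geodesic_segment p r b -> 0 <= l <= 1 ->
  mdist (a (l * mdist p q)) (b (l * mdist p r)) <= l * mdist q r.
Proof.
move=> ga gb /andP[l0 l1].
have [[A0 B0] C0] := (mdist_ge0 p q, mdist_ge0 p r, mdist_ge0 q r).
have T1 : mdist p q <= mdist p r + mdist q r by exact: mdist_triangle_r.
have T2 : mdist p r <= mdist p q + mdist q r by exact: metric_triangle.
have T3 : mdist q r <= mdist p q + mdist p r by exact: mdist_triangle_l.
have [x [y [E1 E2 E3]]] := exists_comparison_triangle A0 B0 C0 T1 T2 T3.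
have := X_CAT0.2 p q r a b (0, 0) (mdist p q, 0) (x, y) (l * mdist p q, 0)
  (l * x, l * y) (l * mdist p q) (l * mdist p r) ga gb.
rewrite /on_euclid_segment /euclid /=.
have -> : Num.sqrt ((0 - mdist p q) ^+ 2 + (0 - 0) ^+ 2) = mdist p q.
  by apply: sqrt_eq_sqr => //; ring.
have -> : Num.sqrt ((0 - x) ^+ 2 + (0 - y) ^+ 2) = mdist p r.
  by apply: sqrt_eq_sqr => //; rewrite -E1; ring.
have -> : Num.sqrt ((mdist p q - x) ^+ 2 + (0 - y) ^+ 2) = mdist q r.
  by apply: sqrt_eq_sqr => //; rewrite -E2; ring.
have -> : Num.sqrt ((0 - l * mdist p q) ^+ 2 + (0 - 0) ^+ 2) = l * mdist p q.
  by apply: sqrt_eq_sqr; [rewrite mulr_ge0 | ring].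
have -> : Num.sqrt ((0 - l * x) ^+ 2 + (0 - l * y) ^+ 2) = l * mdist p r.
  by apply: sqrt_eq_sqr; [rewrite mulr_ge0 | rewrite exprMn -E1; ring].
have -> : Num.sqrt ((l * mdist p q - mdist p q) ^+ 2 + (0 - 0) ^+ 2) =
    (1 - l) * mdist p q.
  by apply: sqrt_eq_sqr; [rewrite mulr_ge0// subr_ge0 | ring].
have -> : Num.sqrt ((l * x - x) ^+ 2 + (l * y - y) ^+ 2) = (1 - l) * mdist p r.
  by apply: sqrt_eq_sqr; [rewrite mulr_ge0// subr_ge0 |
    rewrite exprMn -E1; ring].
have -> : Num.sqrt ((l * mdist p q - l * x) ^+ 2 + (0 - l * y) ^+ 2) =
    l * mdist q r.
  by apply: sqrt_eq_sqr; [rewrite mulr_ge0 | rewrite exprMn -E2; ring].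
apply => //; rewrite ?mulr_ge0//= ?ler_piMl//; ring.
Qed.

Lemma CAT0_midpoint x y : exists m, forall z,
  4 * mdist z m ^+ 2 <= 2 * mdist z x ^+ 2 + 2 * mdist z y ^+ 2 - mdist x y ^+ 2.
Proof.
have [a ga] := X_CAT0.1 x y; exists (a (mdist x y / 2)) => z.
have d0 := mdist_ge0 x y.
have := @CAT0_stewart x y z a (mdist x y / 2) ga.
have [d00|dn0] := eqVneq (mdist x y) 0.
  move=> _; rewrite d00 mul0r; have -> : a 0 = x by case: ga.
  by rewrite -(mdist_positivity _ _ d00); nra.
have dp : 0 < mdist x y by rewrite lt_def dn0.
have -> : 0 <= mdist x y / 2 <= mdist x y by apply/andP; split; lra.
move=> /(_ isT) h.
rewrite -(ler_pM2l dp); nra.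
Qed.

(** Halving one diagonal of a quadrilateral bounds the sum of the squares of
    the diagonals by that of the sides. *)
Lemma CAT0_quadrilateral x y x' y' :
  mdist x y' ^+ 2 + mdist y x' ^+ 2 <= mdist x x' ^+ 2 + mdist y y' ^+ 2 +
    mdist x y ^+ 2 + mdist x' y' ^+ 2.
Proof.
have [m hm] := CAT0_midpoint x y'.
have h1 := hm y; have h2 := hm x'.
have h3 : mdist y x' <= mdist y m + mdist x' m by exact: mdist_triangle_r.
rewrite (metric_sym y x) in h1; rewrite (metric_sym x' x) in h2.
have h4 : mdist y x' ^+ 2 <= (mdist y m + mdist x' m) ^+ 2.
  by rewrite lerXn2r ?nnegrE ?addr_ge0 ?mdist_ge0.
have h5 := sqr_ge0 (mdist y m - mdist x' m).
nra.
Qed.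

End Comparison.

(** * Projection to a geodesic *)

Section Projection.
Context {R : realType} {X : metricType R}.
Hypothesis X_CAT0 : CAT0 X.
Implicit Types (x y z r : X) (I J : set R) (a : R -> X).

Lemma geodesic_subsegment I a s u : geodesic I a -> I s -> I u -> s <= u ->
  geodesic_segment (a s) (a u) (fun v => a (s + v)).
Proof.
move=> [iI aE] Is Iu su.
have D : mdist (a s) (a u) = u - s by rewrite aE// distrC ger0_norm// subr_ge0.
split; rewrite ?D ?addr0 ?subrKC//.
split; first exact: interval_is_interval.
move=> v w /=; rewrite !in_itv/= => /andP[v0 vD] /andP[w0 wD].
rewrite aE; first by congr (`|_|); ring.
- by apply: (iI s u) => //; apply/andP; split; lra.
- by apply: (iI s u) => //; apply/andP; split; lra.
Qed.

Lemma interval_convex I s u l : is_interval I -> I s -> I u -> 0 <= l <= 1 ->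
  I ((1 - l) * s + l * u).
Proof.
move=> iI Is Iu /andP[l0 l1]; have [su|us] := leP s u.
  by apply: (iI s u) => //; apply/andP; split; nra.
by apply: (iI u s) => //; apply/andP; split; nra.
Qed.

Lemma geodesic_stewart I a s u l r : geodesic I a -> I s -> I u ->
  0 <= l <= 1 ->
  mdist r (a ((1 - l) * s + l * u)) ^+ 2 <=
    (1 - l) * mdist r (a s) ^+ 2 + l * mdist r (a u) ^+ 2 -
      l * (1 - l) * (s - u) ^+ 2.
Proof.
move=> ga; have [_ aE] := ga.
wlog su : s u l / s <= u.
  move=> H Is Iu l01; have [|us] := leP s u; first by move=> su; exact: H.
  have l01' : 0 <= 1 - l <= 1 by lra.
  have -> : (1 - l) * s + l * u = (1 - (1 - l)) * u + (1 - l) * s by ring.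
  apply: (le_trans (H u s (1 - l) (ltW us) Iu Is l01')).
  by rewrite le_eqVlt; apply/orP; left; apply/eqP; ring.
move=> Is Iu /andP[l0 l1].
have gs := geodesic_subsegment ga Is Iu su.
have D : mdist (a s) (a u) = u - s by rewrite aE// distrC ger0_norm// subr_ge0.
have [<-|nsu] := eqVneq s u.
  have -> : (1 - l) * s + l * s = s by ring.
  nra.
have lt_su : 0 < u - s by rewrite subr_gt0 lt_def eq_sym nsu.
have := @CAT0_stewart _ _ X_CAT0 _ _ r _ (l * (u - s)) gs.
rewrite D.
have -> : s + l * (u - s) = (1 - l) * s + l * u by ring.
have -> : 0 <= l * (u - s) <= u - s by apply/andP; split; nra.
move=> /(_ isT) h.
rewrite -(ler_pM2l lt_su); apply: (le_trans h); rewrite le_eqVlt.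
by apply/orP; left; apply/eqP; ring.
Qed.

(** The angle at the foot of the projection is at least right. *)
Lemma proj_pythagoras I a x t s : geodesic I a -> is_proj I a x t -> I s ->
  mdist x (a t) ^+ 2 + (t - s) ^+ 2 <= mdist x (a s) ^+ 2.
Proof.
move=> ga [It tmin] Is; rewrite leNgt; apply/negP => lt.
set A := mdist x (a t) in tmin lt *; set B := mdist x (a s) in lt.
have AB : A ^+ 2 <= B ^+ 2.
  by rewrite lerXn2r ?nnegrE ?mdist_ge0//; exact: tmin.
pose D := (t - s) ^+ 2.
have D0 : 0 < D by rewrite /D; lra.
(* a point close enough to the foot is strictly closer to x *)
pose l := (D - (B ^+ 2 - A ^+ 2)) / (2 * D).
have lD : 2 * (l * D) = D - (B ^+ 2 - A ^+ 2) by rewrite /l; field; lra.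
have l0 : 0 < l by apply: divr_gt0; [rewrite /D; lra | lra].
have l1 : l <= 1.
  rewrite /l ler_pdivrMr; last by lra.
  by rewrite mul1r; lra.
have l01 : 0 <= l <= 1 by rewrite (ltW l0).
have := geodesic_stewart x ga It Is l01.
have : A ^+ 2 <= mdist x (a ((1 - l) * t + l * s)) ^+ 2.
  rewrite lerXn2r ?nnegrE ?mdist_ge0//; apply: tmin.
  by apply: interval_convex => //; case: ga.
rewrite -/A -/B -/D => h1 h2.
have : l * ((1 - l) * D) <= l * (B ^+ 2 - A ^+ 2) by nra.
rewrite ler_pM2l//; nra.
Qed.

Lemma proj_unique I a x t s : geodesic I a -> is_proj I a x t ->
  is_proj I a x s -> t = s.
Proof.
move=> ga pt ps; have := proj_pythagoras ga pt ps.1.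
have := proj_pythagoras ga ps pt.1 => h1 h2.
have : (t - s) ^+ 2 <= 0 by nra.
by rewrite real_exprn_even_le0 ?num_real//= subr_eq0 => /eqP.
Qed.

(** In the quadrilateral formed by two points and their projections, the right
    angles make the diagonals long. *)
Lemma proj_lipschitz I a x y t s : geodesic I a -> is_proj I a x t ->
  is_proj I a y s -> `|t - s| <= mdist x y.
Proof.
move=> ga pt ps; have h1 := proj_pythagoras ga pt ps.1.
have h2 := proj_pythagoras ga ps pt.1.
have := CAT0_quadrilateral X_CAT0 x y (a t) (a s).
have -> : mdist (a t) (a s) ^+ 2 = (t - s) ^+ 2.
  by case: ga => _ ->; rewrite ?real_normK ?num_real//; [case: pt | case: ps].
move=> h3; rewrite -ler_sqr ?nnegrE ?mdist_ge0//.
rewrite real_normK ?num_real//; nra.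
Qed.

Lemma proj_self I a t : geodesic I a -> I t -> is_proj I a (a t) t.
Proof. by move=> ga It; split => // s Is; rewrite mdistxx mdist_ge0. Qed.

(** By the triangle inequality, a point of the geodesic closer to w than the foot
    would also be closer to x. *)
Lemma proj_star I a x t w : is_proj I a x t ->
  mdist x w + mdist w (a t) = mdist x (a t) -> is_proj I a w t.
Proof.
move=> [It tmin] E; split => // s Is.
have := tmin s Is; have := metric_triangle x w (a s); lra.
Qed.

Lemma is_proj_clamp I a x t lo hi : geodesic I a -> lo <= hi ->
  `[lo, hi] `<=` I -> is_proj I a x t ->
  is_proj `[lo, hi] a x (Num.min (Num.max t lo) hi).
Proof.
move=> ga lohi sub pt; have [It tmin] := pt.
have inlo : `[lo, hi]%classic lo by rewrite /= in_itv/= lexx.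
have inhi : `[lo, hi]%classic hi by rewrite /= in_itv/= lexx lohi.
have key c s : I c -> I s -> (s <= c <= t) || (t <= c <= s) ->
    mdist x (a c) <= mdist x (a s).
  move=> Ic Is csb.
  have [st|nst] := eqVneq s t.
    have -> : c = s by rewrite st in csb *; lra.
    by [].
  pose l := (c - s) / (t - s).
  have ts0 : t - s != 0 by rewrite subr_eq0 eq_sym.
  have l01 : 0 <= l <= 1.
    case/orP: csb => /andP[h1 h2].
      have ts : 0 < t - s by rewrite lt_def ts0 subr_ge0 (le_trans h1).
      by rewrite /l divr_ge0 ?(ltW ts) ?subr_ge0//= ler_pdivrMr//; lra.
    have ts : 0 < s - t by rewrite lt_def -oppr_eq0 opprB ts0 subr_ge0 (le_trans h1).
    have -> : l = (s - c) / (s - t) by rewrite /l -mulrNN -invrN !opprB.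
    by rewrite divr_ge0 ?(ltW ts) ?subr_ge0//= ler_pdivrMr//; lra.
  have cE : c = (1 - l) * s + l * t.
    rewrite /l; field; exact: ts0.
  have := geodesic_stewart x ga Is It l01; rewrite -cE => h.
  have h2 : mdist x (a t) ^+ 2 <= mdist x (a s) ^+ 2.
    by rewrite lerXn2r ?nnegrE ?mdist_ge0//; exact: tmin.
  rewrite -ler_sqr ?nnegrE ?mdist_ge0//; apply: (le_trans h).
  have := sqr_ge0 (s - t); case/andP: l01 => l0 l1; nra.
have [tlo|lot] := leP t lo.
  rewrite min_l//; split => // s sin.
  apply: key; [exact: sub | exact: sub |].
  by move: sin; rewrite /= in_itv/= tlo => /andP[-> _]; rewrite orbT.
have [thi|hit] := leP t hi.
  split => [|s sin]; first by rewrite /= in_itv/= (ltW lot).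
  exact: tmin (sub _ sin).
split => // s sin.
apply: key; [exact: sub | exact: sub |].
by move: sin; rewrite /= in_itv/= (ltW hit) => /andP[_ ->].
Qed.

(** The distance to x is a convex function along a geodesic, so that an interior
    local minimum is a global one. *)
Lemma is_proj_extend I a x t lo hi : geodesic I a -> `[lo, hi] `<=` I ->
  lo < t < hi -> is_proj `[lo, hi] a x t -> is_proj I a x t.
Proof.
move=> ga sub /andP[lot thi] [tin tmin]; have It := sub _ tin.
split => // s Is; rewrite leNgt; apply/negP => lt.
pose e := Num.min (t - lo) (hi - t).
have e0 : 0 < e by rewrite lt_min !subr_gt0 lot.
have [e1 e2] : e <= t - lo /\ e <= hi - t by rewrite /e !ge_min !lexx orbT.
have n0 := normr_ge0 (s - t).
pose l := e / (e + `|s - t|).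
have en : 0 < e + `|s - t| by lra.
have l0 : 0 < l by rewrite divr_gt0.
have l1 : l <= 1 by rewrite ler_pdivrMr//; lra.
have le : `|l * (s - t)| <= e.
  rewrite normrM (gtr0_norm l0) /l mulrAC ler_pdivrMr//; nra.
have l01 : 0 <= l <= 1 by rewrite (ltW l0).
have := geodesic_stewart x ga It Is l01.
have : mdist x (a t) ^+ 2 <= mdist x (a ((1 - l) * t + l * s)) ^+ 2.
  rewrite lerXn2r ?nnegrE ?mdist_ge0//; apply: tmin.
  rewrite /= in_itv/=; move: le; rewrite ler_norml => /andP[h1 h2].
  by apply/andP; split; nra.
have : mdist x (a s) ^+ 2 < mdist x (a t) ^+ 2.
  by rewrite ltrXn2r ?nnegrE ?mdist_ge0.
have := sqr_ge0 (t - s) => h0 h1 h2 h3.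
have : l * ((1 - l) * (t - s) ^+ 2) >= 0.
  by apply: mulr_ge0; [exact: ltW | apply: mulr_ge0 => //; lra].
nra.
Qed.

Lemma lipschitz_within_continuous (U V : metricType R) (A : set U) (f : U -> V) :
  (forall u v, A u -> A v -> mdist (f u) (f v) <= mdist u v) ->
  {within A, continuous f}.
Proof.
move=> fL; apply/subspace_continuousP => u Au.
apply/metricType_numDomainType.cvgrPdist_lt => e e0.
rewrite near_withinE; apply/metricType_numDomainType.nbhs_mdistP; exists e => //= v ue Av.
exact: le_lt_trans (fL _ _ Au Av) ue.
Qed.

Lemma mdist_normE (s t : R) : mdist (s : R^o) (t : R^o) = `|s - t|.
Proof. exact: distrC. Qed.

Lemma geodesic_connected I a s t : geodesic I a -> I s -> I t ->
  connected (a @` [set u | (s <= u <= t) || (t <= u <= s)]).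
Proof.
move=> [iI aE] Is It; apply: connected_continuous_connected.
  apply/connected_intervalP => u v; rewrite /= => hu hv w /andP[h1 h2]; lra.
apply: (@lipschitz_within_continuous R^o X) => u v /= hu hv.
have sub w : (s <= w <= t) || (t <= w <= s) -> I w.
  by case/orP => h; [exact: (iI s t) | exact: (iI t s)].
by rewrite aE ?mdist_normE//; apply: sub.
Qed.

(** Such a preimage is star-shaped around the piece of the geodesic over J. *)
Lemma proj_preimage_connected I a J : geodesic I a -> is_interval J ->
  J `<=` I -> connected (proj_preimage I a J).
Proof.
move=> ga iJ JI.
have [->|/set0P[x0 [t0 p0 J0]]] := eqVneq (proj_preimage I a J) set0.
  exact: connected0.
pose between s t := [set u | (s <= u <= t) || (t <= u <= s)] : set R.
pose legs := [set i : X * R * (R -> X) |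
  [/\ is_proj I a i.1.1 i.1.2, J i.1.2 &
      geodesic_segment i.1.1 (a i.1.2) i.2]].
pose path (i : X * R * (R -> X)) :=
  i.2 @` between 0 (mdist i.1.1 (a i.1.2)) `|` a @` between i.1.2 t0.
have -> : proj_preimage I a J = \bigcup_(i in legs) path i.
  apply/seteqP; split => [x [t pt Jt]|w [[[x t] b] [/= pt Jt gb]]].
    have [b gb] := X_CAT0.1 x (a t).
    exists (x, t, b) => //; left; exists 0; last by case: gb.
    by rewrite /between/= lexx mdist_ge0.
  have d0 := mdist_ge0 x (a t).
  case=> -[u ub <-].
    have ub' : 0 <= u <= mdist x (a t) by move: ub; rewrite /between/=; lra.
    exists t => //; apply: (proj_star pt).
    by rewrite (segment_mdistl gb)// (segment_mdistr gb)// subrKC.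
  have Ju : J u by case/orP: ub => h; [exact: (iJ t t0) | exact: (iJ t0 t)].
  by exists u => //; apply: proj_self => //; exact: JI.
have between_r s t : between s t t.
  by rewrite /between/= lexx andbT; case: (leP s t) => //= /ltW ->.
have between_l s t : between s t s.
  by rewrite /between/= lexx /=; case: (leP s t) => //= /ltW ->.
apply: bigcup_connected.
  by exists (a t0) => -[[x t] b] _; right; exists t0.
move=> [[x t] b] [/= pt Jt gb].
have [gb1 b0 bd] := gb.
apply: connectedU.
- exists (a t); split; last by exists t.
  by exists (mdist x (a t)).
- by apply: (geodesic_connected gb1); rewrite /= in_itv/= lexx mdist_ge0.
- by apply: (geodesic_connected ga); exact: JI.
Qed.

Lemma exists_proj lo hi a x : lo <= hi -> geodesic `[lo, hi] a ->
  exists t, is_proj `[lo, hi] a x t.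
Proof.
move=> lohi [_ aE].
have [|t tin tmin] := @EVT_min R (fun s => mdist x (a s)) lo hi lohi.
  apply: (@lipschitz_within_continuous R^o R^o) => u v hu hv.
  rewrite !mdist_normE -(aE u v)// ler_norml.
  have := metric_triangle x (a u) (a v); have := metric_triangle x (a v) (a u).
  rewrite (metric_sym (a v)); lra.
by exists t; split => // s /= sin; exact: tmin.
Qed.

End Projection.

(** * Signed coordinates of curtains *)

Section Sides.
Context {R : realType} {X : metricType R}.
Implicit Types (x y z u v o : X) (S T : X -> R) (h k : curtain X).

(** A signed coordinate in which the curtain is the band of values of absolute
    value at most one half.  Either half space may be the negative one, so that
    all the curtains of a family can be oriented the same way; the three
    connectedness clauses replace convexity, which fails for curtains. *)
Record is_side h S : Prop := IsSide {
  side_lipschitz : forall u v, `|S u - S v| <= mdist u v;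
  side_setE : curtain_set h = [set u | - 2^-1 <= S u <= 2^-1];
  side_halfspaces :
    halfspace_minus h = [set u | S u < - 2^-1] /\
    halfspace_plus h = [set u | 2^-1 < S u] \/
    halfspace_minus h = [set u | 2^-1 < S u] /\
    halfspace_plus h = [set u | S u < - 2^-1];
  side_connected : connected [set u | - 2^-1 <= S u <= 2^-1];
  side_connected_le : connected [set u | S u <= 2^-1];
  side_connected_ge : connected [set u | - 2^-1 <= S u];
  side_center : exists u, S u = 0 }.

Lemma is_side_opp h S : is_side h S -> is_side h (fun u => - S u).
Proof.
have Ele (f : X -> R) (c : R) : [set u | - f u <= c] = [set u | - c <= f u].
  by apply/seteqP; split => u /=; lra.
have Ege (f : X -> R) (c : R) : [set u | - c <= - f u] = [set u | f u <= c].
  by apply/seteqP; split => u /=; lra.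
have Elt (f : X -> R) (c : R) : [set u | - f u < - c] = [set u | c < f u].
  by apply/seteqP; split => u /=; lra.
have Egt (f : X -> R) (c : R) : [set u | c < - f u] = [set u | f u < - c].
  by apply/seteqP; split => u /=; lra.
have Eb (f : X -> R) (c : R) :
    [set u | - c <= - f u <= c] = [set u | - c <= f u <= c].
  by apply/seteqP; split => u /=; lra.
move=> [SL SE Sh Sc Scl Scg [u Su]]; split; rewrite ?Ele ?Ege ?Elt ?Egt ?Eb//.
- by move=> v w; rewrite -opprD normrN.
- tauto.
- by exists u; rewrite Su oppr0.
Qed.

Lemma side_separates h S (A B : set X) : is_side h S ->
  (forall u, A u -> S u < - 2^-1) -> (forall u, B u -> 2^-1 < S u) ->
  separates h A B.
Proof.
by move=> hS AS BS; case: (side_halfspaces hS) => -[Em Ep]; [left|right];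
  rewrite Em Ep.
Qed.

Lemma separates_side h S (A B : set X) : is_side h S -> separates h A B ->
  (forall u, A u -> S u < - 2^-1) /\ (forall u, B u -> 2^-1 < S u) \/
  (forall u, A u -> 2^-1 < S u) /\ (forall u, B u -> S u < - 2^-1).
Proof.
move=> hS; rewrite /separates.
case: (side_halfspaces hS) => -[-> ->]; last tauto.
by [].
Qed.

Lemma exists_side_separating h S x y : is_side h S ->
  separates h [set x] [set y] ->
  exists T, [/\ is_side h T, T x < - 2^-1 & 2^-1 < T y].
Proof.
move=> hS /(separates_side hS) [[Sx Sy]|[Sx Sy]].
  by exists S; split => //; [exact: Sx | exact: Sy].
exists (fun u => - S u); split; first exact: is_side_opp.
  by have := Sx x erefl; lra.
by have := Sy y erefl; lra.
Qed.

Lemma connected_one_side h S (A : set X) u v : is_side h S -> connected A ->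
  (forall w, A w -> ~ curtain_set h w) -> A u -> A v -> S u < - 2^-1 -> S v < - 2^-1.
Proof.
move=> hS cA dis Au Av Su; rewrite ltNge; apply/negP => Sv.
have := @connected_continuous_connected X R^o A S cA.
have cS : {within A, continuous (S : X -> R^o)}.
  apply: (@lipschitz_within_continuous _ X R^o) => w w' _ _.
  by rewrite mdist_normE; exact: side_lipschitz hS _ _.
move=> /(_ cS) /connected_intervalP /(_ (S u) (S v)).
move=> /(_ (ex_intro2 _ _ u Au erefl) (ex_intro2 _ _ v Av erefl) (- 2^-1)).
have -> : S u <= - 2^-1 <= S v by rewrite (ltW Su).
move=> /(_ isT) [w Aw Sw].
by apply: (dis w Aw); rewrite (side_setE hS)/= Sw; lra.
Qed.

(** Comparing the closed negative side of one curtain with the open negative side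
    of the next makes the two curtains disjoint. *)
Definition nested S T := forall u, S u <= 2^-1 -> T u < - 2^-1.

Lemma nested_gt S T u : nested S T -> - 2^-1 <= T u -> 2^-1 < S u.
Proof. by move=> ST Tu; rewrite ltNge; apply/negP => /ST; lra. Qed.

Lemma nested_lt S T u : nested S T -> S u < - 2^-1 -> T u < - 2^-1.
Proof. by move=> ST Su; apply: ST; lra. Qed.

Lemma nested_trans S T U : nested S T -> nested T U -> nested S U.
Proof. by move=> ST TU u /ST Tu; apply: TU; lra. Qed.

Lemma nested_disjoint h k S T : is_side h S -> is_side k T -> nested S T ->
  curtain_set h `&` curtain_set k = set0.
Proof.
move=> hS kT ST; apply/seteqP; split => u //.
rewrite (side_setE hS) (side_setE kT) => -[/= /andP[_ /ST Tu] /andP[Tu' _]]; lra.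
Qed.

(** The curtain k is connected, hence on one side of h; then the opposite closed
    side of h is disjoint from k and connected, hence on one side of k, which o
    or o' determines. *)
Lemma disjoint_nested h k S T o o' : is_side h S -> is_side k T ->
  (forall u, curtain_set h u -> ~ curtain_set k u) ->
  S o < - 2^-1 -> T o < - 2^-1 -> 2^-1 < S o' -> 2^-1 < T o' ->
  nested S T \/ nested T S.
Proof.
move=> hS kT dis So To So' To'; have [c Tc] := side_center kT.
have kc : curtain_set k c by rewrite (side_setE kT)/= Tc; lra.
have kcon : connected (curtain_set k).
  by rewrite (side_setE kT); exact: side_connected kT.
have [Sc|Sc] := ltP (S c) (- 2^-1).
  have kS v : curtain_set k v -> S v < - 2^-1.
    by move=> kv; by apply: (connected_one_side hS kcon _ kc kv Sc) => w kw /dis.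
  right => u Tu; rewrite ltNge; apply/negP => Su.
  have := connected_one_side (is_side_opp kT) (side_connected_ge hS) _
    (_ : [set u | - 2^-1 <= S u] o') (_ : [set u | - 2^-1 <= S u] u).
  suff H : - T o' < - 2^-1 /\ - 2^-1 <= S o'.
    move=> /(_ _ H.2 Su H.1) H1; suff : - T u < - 2^-1 by lra.
    by apply: H1 => v /= Sv /kS; lra.
  lra.
have kS v : curtain_set k v -> 2^-1 < S v.
  have hS' := is_side_opp hS; move=> kv.
  have Sc' : 2^-1 < S c.
    rewrite ltNge; apply/negP => Sc'.
    by apply: (dis c) => //; rewrite (side_setE hS)/= Sc.
  have H : - S c < - 2^-1 by lra.
  have : - S v < - 2^-1.
    by apply: (connected_one_side hS' kcon _ kc kv H) => w kw /dis.
  lra.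
left => u Su.
apply: (connected_one_side kT (side_connected_le hS) _ (_ : _ o) Su To) => /=.
  by move=> v Sv /kS; lra.
lra.
Qed.

Hypothesis X_CAT0 : CAT0 X.

Lemma is_side_proj h (P : X -> R) :
  (forall u, is_proj (curtain_dom h) (curtain_geo h) u (P u)) ->
  is_side h (fun u => P u - curtain_pole h).
Proof.
move=> hP; set p := curtain_pole h.
have ga := curtain_geoP h; have Isub := subset_trans (@curtain_poleP _ _ h) (@interior_subset _ _).
have PI u : curtain_dom h (P u) by case: (hP u).
have preE (J : set R) : proj_preimage (curtain_dom h) (curtain_geo h) J =
    [set u | J (P u)].
  apply/seteqP; split => [u [t pt Jt]|u Ju] /=; last by exists (P u).
  by rewrite (proj_unique X_CAT0 ga (hP u) pt).
have con (J : set R) : is_interval J -> connected [set u | J (P u)].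
  move=> iJ; have -> : [set u | J (P u)] =
      [set u | (J `&` curtain_dom h) (P u)].
    by apply/seteqP; split => u; [move=> Ju; split|case].
  rewrite -preE; apply: proj_preimage_connected => //.
  move=> s t [Js Is] [Jt It] u su; split; first exact: (iJ s t).
  by case: ga => iI _; exact: (iI s t).
split.
- move=> u v; have -> : P u - p - (P v - p) = P u - P v by ring.
  exact: (proj_lipschitz X_CAT0 ga).
- by rewrite /curtain_set preE -/p; apply/seteqP; split => u /=;
    rewrite in_itv/=; lra.
- left; rewrite /halfspace_minus /halfspace_plus !preE -/p.
  by split; apply/seteqP; split => u /=; rewrite in_itv/= ?andbT; lra.
- have -> : [set u | - 2^-1 <= P u - p <= 2^-1] =
      [set u | `[p - 2^-1, p + 2^-1]%classic (P u)].
    by apply/seteqP; split => u /=; rewrite in_itv/=; lra.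
  apply: con; exact: interval_is_interval.
- have -> : [set u | P u - p <= 2^-1] = [set u | `]-oo, p + 2^-1]%classic (P u)].
    by apply/seteqP; split => u /=; rewrite in_itv/=; lra.
  apply: con; exact: interval_is_interval.
- have -> : [set u | - 2^-1 <= P u - p] = [set u | `[p - 2^-1, +oo[%classic (P u)].
    by apply/seteqP; split => u /=; rewrite in_itv/= ?andbT; lra.
  apply: con; exact: interval_is_interval.
- exists (curtain_geo h p); apply/eqP; rewrite subr_eq0; apply/eqP.
  apply: (proj_unique X_CAT0 ga (hP _)); apply: (proj_self ga).
  by apply: Isub; rewrite /= in_itv/= -/p; lra.
Qed.

Lemma exists_proj_fun lo hi (a : R -> X) : lo <= hi -> geodesic `[lo, hi] a ->
  exists P : X -> R, forall u, is_proj `[lo, hi] a u (P u).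
Proof.
move=> lohi ga; have /choice[P hP] := fun u => exists_proj u lohi ga.
by exists P.
Qed.

(** On a compact piece of the geodesic around the band every point has a
    projection, and shrinking the geodesic clamps the projections: this keeps
    the curtain and can only enlarge its half spaces. *)
Lemma exists_side_truncation h : exists k S, [/\ is_side k S,
  curtain_set k = curtain_set h, halfspace_minus h `<=` halfspace_minus k &
  halfspace_plus h `<=` halfspace_plus k].
Proof.
have ga := curtain_geoP h; set I := curtain_dom h in ga.
set a := curtain_geo h in ga; set p := curtain_pole h.
have sub : `[p - 2^-1, p + 2^-1]%classic `<=` I° by exact: curtain_poleP.
have [e1 e10 he1] : exists2 e : R, 0 < e & I (p + 2^-1 + e).
  have /nbhs_ballP[e /= e0 he] := sub (p + 2^-1) ltac:(rewrite /= in_itv/=; lra).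
  exists (e / 2); first lra; apply: he; rewrite /ball/= opprD addNKr normrN.
  by rewrite gtr0_norm; lra.
have [e2 e20 he2] : exists2 e : R, 0 < e & I (p - 2^-1 - e).
  have /nbhs_ballP[e /= e0 he] := sub (p - 2^-1) ltac:(rewrite /= in_itv/=; lra).
  exists (e / 2); first lra; apply: he; rewrite /ball/= opprB addrC subrK.
  by rewrite gtr0_norm; lra.
pose lo := p - 2^-1 - e2; pose hi := p + 2^-1 + e1.
have IJ : `[lo, hi]%classic `<=` I.
  by move=> t; rewrite /= in_itv/= => tin; case: ga => iI _; exact: (iI lo hi).
have gJ : geodesic `[lo, hi]%classic a.
  split; first exact: interval_is_interval.
  by move=> s t /IJ Is /IJ It; case: ga => _; exact.
have pJ : `[p - 2^-1, p + 2^-1]%classic `<=` `[lo, hi]%classic°.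
  rewrite interior_itv_bnd => t; rewrite /= !in_itv/= /lo /hi; lra.
have lohi : lo <= hi by rewrite /lo /hi; lra.
have [P hP] := exists_proj_fun lohi gJ.
exists (Curtain gJ pJ), (fun u => P u - p); split.
- exact: (@is_side_proj (Curtain gJ pJ)).
- rewrite /curtain_set/= -/p -/I -/a; apply/seteqP; split => u [t pt tin].
    exists t => //; apply: (is_proj_extend X_CAT0 ga IJ _ pt).
    by move: tin; rewrite /= in_itv/= /lo /hi; lra.
  exists t => //; have := is_proj_clamp X_CAT0 ga lohi IJ pt.
  move: tin; rewrite /= in_itv/= => /andP[h1 h2].
  by rewrite max_l ?min_l// /lo /hi; lra.
- rewrite /halfspace_minus/= -/p -/I -/a => u [t pt].
  rewrite /= in_itv/= => tp.
  exists (Num.min (Num.max t lo) hi); first exact: (is_proj_clamp X_CAT0 ga).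
  by rewrite /= in_itv/= gt_min gt_max tp/= /lo; apply/orP; left; lra.
- rewrite /halfspace_plus/= -/p -/I -/a => u [t pt].
  rewrite /= in_itv/= andbT => tp.
  exists (Num.min (Num.max t lo) hi); first exact: (is_proj_clamp X_CAT0 ga).
  by rewrite /= in_itv/= andbT lt_min lt_max tp/= /hi; lra.
Qed.

End Sides.

Section Push.
Context {R : realType} {X : metricType R}.
Variables (f f' : X -> X).
Hypotheses (fK : cancel f f') (f'K : cancel f' f).
Hypothesis f_isom : forall x y, mdist (f x) (f y) = mdist x y.
Implicit Types (h k : curtain X).

Lemma geodesic_push (I : set R) (a : R -> X) : geodesic I a ->
  geodesic I (f \o a).
Proof. by move=> [iI aE]; split => // s t Is It /=; rewrite f_isom aE. Qed.

Definition push h : curtain X :=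
  Curtain (geodesic_push (curtain_geoP h)) (@curtain_poleP _ _ h).

Lemma inv_isom x y : mdist (f' x) (f' y) = mdist x y.
Proof. by rewrite -f_isom !f'K. Qed.

Lemma push_preimage I (a : R -> X) J :
  proj_preimage I (f \o a) J = [set u | proj_preimage I a J (f' u)].
Proof.
apply/seteqP; split => u /= [t [It tmin] Jt]; exists t => //; split => // s Is.
  by have := tmin s Is; rewrite /= -!(inv_isom u) !fK.
by rewrite /= -!(inv_isom u) !fK; exact: tmin.
Qed.

Lemma connected_push (A : set X) : connected A -> connected [set u | A (f' u)].
Proof.
move=> cA; have -> : [set u | A (f' u)] = f @` A.
  apply/seteqP; split => [u Au|u [v Av <-]]; last by rewrite /= fK.
  by exists (f' u).
apply: connected_continuous_connected => //.
by apply: lipschitz_within_continuous => u v _ _; rewrite f_isom.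
Qed.

Lemma curtain_set_push h :
  curtain_set (push h) = [set u | curtain_set h (f' u)].
Proof. exact: push_preimage. Qed.

Lemma is_side_push h S : is_side h S -> is_side (push h) (S \o f').
Proof.
move=> [SL SE Sh Sc Scl Scg [u Su]]; split.
- by move=> v w; rewrite -(inv_isom v); exact: SL.
- by rewrite curtain_set_push SE.
- case: Sh => -[Em Ep]; [left|right]; split;
    by rewrite [LHS]push_preimage ?[proj_preimage _ _ _]Em
       ?[proj_preimage _ _ _]Ep.
- exact: (connected_push Sc).
- exact: (connected_push Scl).
- exact: (connected_push Scg).
- by exists (f u); rewrite /= fK.
Qed.

End Push.

(** * Ordered families of curtains and the distances d_L *)

Section Towers.
Context {R : realType} {X : metricType R}.
Hypothesis X_CAT0 : CAT0 X.
Implicit Types (x y z u v o : X) (h : nat -> curtain X) (S : nat -> X -> R).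

Lemma geodesic_level (k : curtain X) (T : X -> R) (I : set R) (a : R -> X) s t
    (c : R) :
  is_side k T -> geodesic I a -> I s -> I t -> s <= t ->
  T (a s) <= c <= T (a t) -> exists2 r, s <= r <= t & T (a r) = c.
Proof.
move=> kT ga Is It st cst.
have := @connected_continuous_connected X R^o _ T (geodesic_connected ga Is It).
have cS A : {within A, continuous (T : X -> R^o)}.
  apply: (@lipschitz_within_continuous _ X R^o) => w w' _ _.
  by rewrite mdist_normE; exact: side_lipschitz kT _ _.
move=> /(_ (cS _)) /connected_intervalP iJ.
have [||_ [r rin <-] <-] := iJ (T (a s)) (T (a t)) _ _ c cst.
- by exists (a s) => //; exists s => //=; rewrite lexx st.
- by exists (a t) => //; exists t => //=; rewrite lexx st.
by exists r => //; move: rin => /=; lra.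
Qed.

Lemma segment_level (k : curtain X) (T : X -> R) u v (a : R -> X) (c : R) :
  is_side k T -> geodesic_segment u v a -> T u <= c <= T v ->
  exists2 t, 0 <= t <= mdist u v & T (a t) = c.
Proof.
move=> kT [ga a0 ad] cuv; have d0 := mdist_ge0 u v.
apply: (geodesic_level kT ga _ _ d0); rewrite ?a0 ?ad//=;
  by rewrite in_itv/= lexx d0.
Qed.

(** Curtains crossed in the order of their indices. *)
Definition tower n h S :=
  (forall i, (i < n)%N -> is_side (h i) (S i)) /\
  (forall i j, (i < j < n)%N -> nested (S i) (S j)).

Definition L_tower L n h S := tower n h S /\
  forall i j, (i < n)%N -> (j < n)%N -> i != j -> L_separated L (h i) (h j).

Definition tower_separates n S x y :=
  forall i, (i < n)%N -> S i x < - 2^-1 /\ 2^-1 < S i y.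

Lemma tower_consecutive n h S : (forall i, (i < n)%N -> is_side (h i) (S i)) ->
  (forall i, (i.+1 < n)%N -> nested (S i) (S i.+1)) -> tower n h S.
Proof.
move=> hS SS; split => // i j; elim: j => // j IH /andP[].
rewrite ltnS leq_eqVlt => /predU1P[->|ij] jn; first exact: SS.
by apply: nested_trans (SS j jn); apply: IH; rewrite ij ltnW.
Qed.

Lemma tower_chain n h S : tower n h S -> chain (fun i : 'I_n => h i).
Proof.
move=> [hS SS]; split.
  move=> i j E; apply/val_inj/eqP => /=; apply: contraT.
  have key (i' j' : nat) : (i' < j' < n)%N ->
      curtain_set (h i') = curtain_set (h j') -> false.
    move=> ij E'; have /andP[lt_ij jn] := ij.
    have hi := hS i' (ltn_trans lt_ij jn); have hj := hS j' jn.
    have [u Su] := side_center hi.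
    have hu : curtain_set (h i') u by rewrite (side_setE hi)/= Su; lra.
    have := nested_disjoint hi hj (SS _ _ ij).
    rewrite -E' setIid => E0; by rewrite E0 in hu.
  rewrite neq_ltn => /orP[lt_ij|lt_ji].
    by apply: key E; rewrite lt_ij/=.
  by apply: key (esym E); rewrite lt_ji/=.
move=> i j k ji kj; apply: (side_separates (hS j (ltn_ord j))) => u.
  rewrite (side_setE (hS i (ltn_ord i))) => /= /andP[_].
  by apply: SS; rewrite -ji leqnn ltn_ord.
rewrite (side_setE (hS k (ltn_ord k))) => /= /andP[+ _].
by apply: nested_gt; apply: SS; rewrite -kj leqnn ltn_ord.
Qed.

(** A geodesic from x to y needs length one to cross the last curtain, and all the
    other curtains have been crossed before it is reached. *)
Lemma tower_mdist n h S x y : tower n h S -> tower_separates n S x y ->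
  n%:R <= mdist x y.
Proof.
elim: n y => [|n IH] y [hS SS] Sxy; first exact: mdist_ge0.
have [a ga] := X_CAT0.1 x y.
have [Sx Sy] := Sxy n (ltnSn n); have hn := hS n (ltnSn n).
have [|t tin St] := segment_level hn ga (_ : S n x <= - 2^-1 <= S n y).
  by lra.
have E := segment_mdistl ga tin; have E' := segment_mdistr ga tin.
have : n%:R <= mdist x (a t).
  apply: IH; first split => [i lin|i j /andP[ij jn]].
  - by apply: hS; rewrite ltnS ltnW.
  - by apply: SS; rewrite ij ltnS ltnW.
  move=> i lin; split; first by case: (Sxy i (leqW lin)).
  apply: (@nested_gt _ _ (S i) (S n)); first by apply: SS; rewrite lin/=.
  by rewrite St.
have := side_lipschitz hn (a t) y; rewrite ler_norml St => /andP[h1 _].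
rewrite -natr1; lra.
Qed.

Lemma L_separated_eq L (h k h' k' : curtain X) : curtain_set h' = curtain_set h ->
  curtain_set k' = curtain_set k -> L_separated L h k -> L_separated L h' k'.
Proof.
move=> hE kE [dis sep]; split; first by rewrite hE kE.
by move=> n c cc cm; apply: (sep n c cc) => i; rewrite /Defs.meets -hE -kE; exact: cm.
Qed.

Lemma L_separated_sym L (h k : curtain X) : L_separated L h k -> L_separated L k h.
Proof.
move=> [dis sep]; split; first by rewrite setIC.
by move=> n c cc cm; apply: (sep n c cc) => i; have [] := cm i.
Qed.

(** Truncated and oriented from x to y, the curtains of an L-chain are crossed in
    the order of their indices or in the reverse order: by disjointness any two
    are comparable, and each one lies between its two neighbours. *)
Lemma L_chain_tower L n (c : 'I_n -> curtain X) x y : (0 < n)%N ->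
  L_chain L c -> chain_separates c [set x] [set y] ->
  exists h S, L_tower L n h S /\ tower_separates n S x y.
Proof.
case: n c => // n c _ [[_ cc] cL] cxy.
have /choice[kT hkT] : forall i : nat, exists kT : curtain X * (X -> R),
    [/\ is_side kT.1 kT.2, curtain_set kT.1 = curtain_set (c (inord i)),
     forall A B, separates (c (inord i)) A B -> separates kT.1 A B,
     kT.2 x < - 2^-1 & 2^-1 < kT.2 y].
  move=> i; have [k [S [kS kE km kp]]] :=
    exists_side_truncation X_CAT0 (c (inord i)).
  have sep A B : separates (c (inord i)) A B -> separates k A B.
    by move=> [[h1 h2]|[h1 h2]]; [left|right]; split;
      apply: subset_trans; eauto.
  have [T [kT Tx Ty]] := exists_side_separating kS (sep _ _ (cxy (inord i))).
  by exists (k, T).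
pose k i := (kT i).1; pose T i := (kT i).2.
have kside i : is_side (k i) (T i) by case: (hkT i).
have kE i : curtain_set (k i) = curtain_set (c (inord i)) by case: (hkT i).
have ksep i A B : separates (c (inord i)) A B -> separates (k i) A B.
  by case: (hkT i) => _ _ + _ _; exact.
have Tx i : T i x < - 2^-1 by case: (hkT i).
have Ty i : 2^-1 < T i y by case: (hkT i).
have kL i j : (i < n.+1)%N -> (j < n.+1)%N -> i != j -> L_separated L (k i) (k j).
  move=> lin jn ij; apply: (L_separated_eq (kE i) (kE j)); apply: cL.
  by apply: contra ij => /eqP/(congr1 val); rewrite /= !inordK// => ->.
have cmp i : (i.+1 < n.+1)%N -> nested (T i) (T i.+1) \/ nested (T i.+1) (T i).
  move=> lin; apply: (disjoint_nested (kside i) (kside i.+1) _ (Tx _) (Tx _)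
    (Ty _) (Ty _)) => u ku ku'.
  have [dis _] := kL i i.+1 (ltnW lin) lin (negbT (ltn_eqF (ltnSn i))).
  suff : (curtain_set (k i) `&` curtain_set (k i.+1)) u by rewrite dis.
  by [].
have kcenter i : exists2 u, curtain_set (k i) u & - 2^-1 <= T i u <= 2^-1.
  have [u Tu] := side_center (kside i).
  by exists u; rewrite ?(side_setE (kside i))/= Tu; lra.
have mid i : (i.+2 < n.+1)%N ->
    (nested (T i) (T i.+1) -> nested (T i.+1) (T i.+2)) /\
    (nested (T i.+1) (T i) -> nested (T i.+2) (T i.+1)).
  move=> lin.
  have sep : separates (k i.+1) (curtain_set (k i)) (curtain_set (k i.+2)).
    apply: ksep; rewrite !kE; apply: cc; rewrite !inordK//; lia.
  have [u ku /andP[Tu Tu']] := kcenter i.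
  have [v kv /andP[Tv Tv']] := kcenter i.+2.
  have out : ~ (T i.+1 u < - 2^-1 /\ T i.+1 v < - 2^-1) /\
      ~ (2^-1 < T i.+1 u /\ 2^-1 < T i.+1 v).
    have [[hu hv]|[hu hv]] := separates_side (kside i.+1) sep;
    by have := hu u ku; have := hv v kv; split => -[]; lra.
  split => TT; case: (cmp i.+1 lin) => // TT'; exfalso.
    by apply: out.1; split; [exact: TT | exact: TT'].
  by apply: out.2; split; [exact: nested_gt TT _ | exact: nested_gt TT' _].
have [n0|n0] := posnP n.
  exists k, T; split; last by move=> i _.
  split; last by move=> i j lin jn ij; exact: kL.
  by apply: tower_consecutive => // i; rewrite n0.
have [T01|T10] := cmp 0%N n0.
  exists k, T; split; last by move=> i _.
  split; last by move=> i j lin jn ij; exact: kL.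
  apply: tower_consecutive => // i; elim: i => // i IH lin.
  by apply: (mid i lin).1; apply: IH; exact: ltnW.
have TS i : (i.+1 < n.+1)%N -> nested (T i.+1) (T i).
  elim: i => // i IH lin; by apply: (mid i lin).2; apply: IH; exact: ltnW.
exists (fun i => k (n - i)%N), (fun i => T (n - i)%N).
split; last by move=> i _.
split; last by move=> i j lin jn ij; apply: kL; lia.
apply: tower_consecutive => // i lin.
have -> : (n - i)%N = (n - i.+1).+1 by lia.
by apply: TS; lia.
Qed.

Lemma L_chain_cards_mdist L x y n : L_chain_cards L x y n -> n%:R <= mdist x y.
Proof.
case: (posnP n) => [-> _|n0 [c [cL cxy]]]; first exact: mdist_ge0.
have [h [S [[hT _] Sxy]]] := L_chain_tower n0 cL cxy.
exact: tower_mdist hT Sxy.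
Qed.

Lemma L_chain_cards0 L x y : L_chain_cards L x y 0%N.
Proof.
have c : 'I_0 -> curtain X by case.
by exists c; split=> [|[]//]; split=> [|[]//]; split=> [[]|[]].
Qed.

Lemma L_dist_le L x y M : 0 <= M ->
  (forall n, L_chain_cards L x y n -> n%:R <= M) -> L_dist L x y <= 1 + M.
Proof.
move=> M0 hM; rewrite /L_dist; case: ifP => _; first lra.
rewrite lerD2l; apply: ge_sup; first by exists 0%:R; exists 0%N => //; exact: L_chain_cards0.
by move=> _ [n hn <-]; exact: hM.
Qed.

Lemma L_dist_le_mdist L x y : L_dist L x y <= 1 + mdist x y.
Proof.
by apply: L_dist_le => [|n]; [exact: mdist_ge0 | exact: L_chain_cards_mdist].
Qed.

Lemma L_dist_ge L x y n : x != y -> L_chain_cards L x y n ->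
  n%:R <= L_dist L x y.
Proof.
move=> xy hn; rewrite /L_dist (negPf xy).
have : n%:R <= sup [set n%:R | n in L_chain_cards L x y] :> R.
  apply: ub_le_sup; last by exists n.
  by exists (mdist x y) => _ [m hm <-]; exact: L_chain_cards_mdist hm.
lra.
Qed.

Lemma L_dist_ge0 L x y : 0 <= L_dist L x y.
Proof.
have [->|xy] := eqVneq x y; first by rewrite /L_dist eqxx.
exact: (L_dist_ge xy (L_chain_cards0 L x y)).
Qed.

End Towers.

(** * The bottleneck property of separated curtains *)

Section Bottleneck.
Context {R : realType} {X : metricType R}.
Hypothesis X_CAT0 : CAT0 X.
Implicit Types (x y z p q u v : X) (a b c : R -> X).

Lemma connected_crosses (k : curtain X) (T : X -> R) (A : set X) u v :
  is_side k T -> connected A -> A u -> A v -> T u < - 2^-1 -> 2^-1 < T v ->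
  curtain_set k `&` A !=set0.
Proof.
move=> kT cA Au Av Tu Tv; apply/set0P/eqP => E.
have : T v < - 2^-1.
  apply: (connected_one_side kT cA _ Au Av Tu) => w Aw kw.
  by suff : (curtain_set k `&` A) w by rewrite E.
lra.
Qed.

Lemma proj_closer (I : set R) a x t s l : geodesic I a -> is_proj I a x t ->
  I s -> s != t -> 0 < l <= 1 ->
  mdist x (a ((1 - l) * s + l * t)) < mdist x (a s).
Proof.
move=> ga pt Is st /andP[l0 l1]; have [It _] := pt.
have l01 : 0 <= l <= 1 by rewrite (ltW l0).
have h1 := geodesic_stewart X_CAT0 x ga Is It l01.
have h2 := proj_pythagoras X_CAT0 ga pt Is.
rewrite -(@ltr_pXn2r _ 2)// ?nnegrE ?mdist_ge0//; apply: le_lt_trans h1 _.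
have st2 : 0 < (t - s) ^+ 2 by rewrite exprn_even_gt0//= subr_eq0 eq_sym.
have -> : (s - t) ^+ 2 = (t - s) ^+ 2 by ring.
have h3 : 0 <= l * (1 - l) * (t - s) ^+ 2.
  by apply: mulr_ge0; [apply: mulr_ge0; lra | exact: ltW].
nra.
Qed.

(** Disjoint dual curtains can be placed side by side along a segment, each
    taking up an interval of length one. *)
Lemma exists_dual_tower p q c n (P : X -> R) : geodesic_segment p q c ->
  (forall u, is_proj `[0, mdist p q] c u (P u)) -> n.+1%:R < mdist p q ->
  exists h S, [/\ tower n.+1 h S,
    forall i u, (i < n.+1)%N -> P u = 0 -> S i u < - 2^-1 &
    forall i u, (i < n.+1)%N -> P u = mdist p q -> 2^-1 < S i u].
Proof.
move=> [gc c0 cd] hP nd; set d := mdist p q in gc cd hP nd *.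
(* the n + 1 segments and the n + 2 gaps of length e between and around them
   fill the segment *)
pose e : R := (d - n.+1%:R) / n.+2%:R.
have dE : d = n.+1%:R + n.+2%:R * e.
  by rewrite /e mulrC divfK ?pnatr_eq0// subrKC.
have e0 : 0 < e by rewrite divr_gt0 ?subr_gt0// ltr0n.
pose r (i : nat) : R := i%:R + 2^-1 + i.+1%:R * e.
have rlo i : 0 < r i - 2^-1.
  have i0 : 0 <= i%:R :> R by exact: ler0n.
  by rewrite /r -[i.+1%:R]natr1; nra.
have rhi i : (i <= n)%N -> r i + 2^-1 < d.
  rewrite -(ler_nat R) => lin; rewrite dE /r -[i.+1%:R]natr1 -[n.+2%:R]natr1 -[n.+1%:R]natr1.
  have : i%:R * e <= n%:R * e by rewrite ler_pM2r.
  lra.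
have rmono i j : (i < j)%N -> r i + 2^-1 < r j - 2^-1.
  rewrite -(ler_nat R) -natr1 => ij; rewrite /r -[i.+1%:R]natr1 -[j.+1%:R]natr1.
  have : (i%:R + 1) * e <= j%:R * e by rewrite ler_pM2r.
  lra.
have dom i : `[r (minn i n) - 2^-1, r (minn i n) + 2^-1]%classic `<=`
    `[0, d]%classic°.
  rewrite interior_itv_bnd => t; rewrite /= !in_itv/=.
  have := rlo (minn i n); have := rhi (minn i n) (geq_minr _ _); lra.
pose h i := Curtain gc (@dom i).
pose S i u := P u - r (minn i n).
have hS i : is_side (h i) (S i) by exact: (@is_side_proj _ _ X_CAT0 (h i)).
have minE i : (i < n.+1)%N -> minn i n = i by rewrite ltnS => /minn_idPl.
exists h, S; split.
- split => // i j /andP[ij jn] u; rewrite /S (minE j)// (minE i); last first.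
    exact: ltn_trans ij jn.
  by have := rmono _ _ ij; lra.
- by move=> i u lin; rewrite /S minE// => ->; have := rlo i; lra.
- by move=> i u lin; rewrite /S minE// => ->; have := rhi i lin; lra.
Qed.

(** A connected set with points projecting to both ends of a segment meets all the
    curtains dual to the segment, of which there are at most L if two L-separated
    curtains do so. *)
Lemma L_separated_crossing L (h k : curtain X) (S T : X -> R) p q c
    (P : X -> R) :
  is_side h S -> is_side k T -> L_separated L h k -> geodesic_segment p q c ->
  (forall u, is_proj `[0, mdist p q] c u (P u)) ->
  curtain_set h `&` [set u | P u = 0] !=set0 ->
  curtain_set k `&` [set u | P u = 0] !=set0 ->
  curtain_set h `&` [set u | P u = mdist p q] !=set0 ->
  curtain_set k `&` [set u | P u = mdist p q] !=set0 ->
  mdist p q <= L.+1%:R.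
Proof.
move=> hS kT [_ sep] gc hP [u [hu Pu]] [v [kv Pv]] [u' [hu' Pu']] [v' [kv' Pv']].
rewrite leNgt; apply/negP => Ld.
have [t [S' [tS t0 td]]] := exists_dual_tower gc hP Ld.
suff /(sep _ _ (tower_chain tS)) : forall i : 'I_L.+1,
    Defs.meets (t i) h /\ Defs.meets (t i) k by rewrite ltnn.
move=> i.
have ti := tS.1 i (ltn_ord i).
have hc : connected (curtain_set h).
  by rewrite (side_setE hS); exact: side_connected hS.
have kc : connected (curtain_set k).
  by rewrite (side_setE kT); exact: side_connected kT.
split.
  exact: (connected_crosses ti hc hu hu' (t0 _ _ _ Pu) (td _ _ _ Pu')).
exact: (connected_crosses ti kc kv kv' (t0 _ _ _ Pv) (td _ _ _ Pv')).
Qed.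

(** Let q be the point of a geodesic a closest to a point p of a geodesic b, and
    let c be the segment from p to q.  All of a projects onto c at q.  At least
    one of the two halves of b at p projects onto c at p, since two points of
    different halves that project elsewhere could be joined by a shortcut.  A
    curtain meeting a and that half of b then meets all the curtains dual to
    c. *)
Lemma bottleneck L x y u v a b s (h1 h2 h3 h4 : curtain X)
    (S1 S2 S3 S4 : X -> R) :
  geodesic_segment x y a -> geodesic_segment u v b -> 0 <= s <= mdist u v ->
  is_side h1 S1 -> is_side h2 S2 -> is_side h3 S3 -> is_side h4 S4 ->
  L_separated L h1 h2 -> L_separated L h3 h4 ->
  (forall h, h = h1 \/ h = h2 ->
    curtain_set h `&` b @` `[0, s]%classic !=set0) ->
  (forall h, h = h3 \/ h = h4 ->
    curtain_set h `&` b @` `[s, mdist u v]%classic !=set0) ->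
  (forall h, [\/ h = h1, h = h2, h = h3 | h = h4] ->
    curtain_set h `&` a @` `[0, mdist x y]%classic !=set0) ->
  exists2 t, 0 <= t <= mdist x y & mdist (b s) (a t) <= L.+1%:R.
Proof.
move=> ga gb hs h1S h2S h3S h4S sep12 sep34 meet12 meet34 meeta.
have [gaI _ _] := ga; have [gbI _ _] := gb.
have [t pt] := exists_proj (b s) (mdist_ge0 x y) gaI.
have [tin _] := pt; exists t; first by move: tin; rewrite /= in_itv.
set p := b s; set q := a t.
have [c gc] := X_CAT0.1 p q; have [gcI c0 cd] := gc.
have [P hP] := exists_proj_fun (mdist_ge0 p q) gcI.
have d0 := mdist_ge0 p q.
have in0 : `[0, mdist p q]%classic 0 by rewrite /= in_itv/= lexx d0.
have ind : `[0, mdist p q]%classic (mdist p q) by rewrite /= in_itv/= lexx d0.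
have Pin w : 0 <= P w <= mdist p q by case: (hP w) => + _; rewrite /= in_itv.
have Pa w : `[0, mdist x y]%classic w -> P (a w) = mdist p q.
  move=> win; have Pw := Pin (a w).
  have pm : is_proj `[0, mdist x y] a (c (P (a w))) t.
    apply: (proj_star pt); rewrite -/p -/q.
    by rewrite (segment_mdistl gc Pw) (segment_mdistr gc Pw) subrKC.
  have e1 := proj_pythagoras X_CAT0 gaI pm win.
  have e2 := proj_pythagoras X_CAT0 gcI (hP (a w)) ind.
  rewrite cd in e2; have e3 : mdist (a w) q ^+ 2 = (t - w) ^+ 2.
    by case: gaI => _ ->//; rewrite real_normK ?num_real//; ring.
  rewrite e3 in e2; rewrite (metric_sym _ (a w)) in e1.
  have : (P (a w) - mdist p q) ^+ 2 <= 0.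
    by have := sqr_ge0 (mdist (c (P (a w))) (a t)); lra.
  by rewrite real_exprn_even_le0 ?num_real//= subr_eq0 => /eqP.
have halves : (forall w, `[0, s]%classic w -> P (b w) = 0) \/
    (forall w, `[s, mdist u v]%classic w -> P (b w) = 0).
  have [|nH] := pselect (forall w, `[0, s]%classic w -> P (b w) = 0).
    by left.
  right => w2; rewrite /= in_itv/= => w2in.
  have [//|P2] := eqVneq (P (b w2)) 0; exfalso.
  apply: nH => w1; rewrite /= in_itv/= => w1in.
  have [//|P1] := eqVneq (P (b w1)) 0; exfalso.
  pose m := Num.min (P (b w1)) (P (b w2)).
  have P1p : 0 < P (b w1) by rewrite lt_def P1; case/andP: (Pin (b w1)).
  have P2p : 0 < P (b w2) by rewrite lt_def P2; case/andP: (Pin (b w2)).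
  have m0 : 0 < m by rewrite lt_min P1p.
  have [m1 m2] : m <= P (b w1) /\ m <= P (b w2).
    by rewrite /m !ge_min !lexx orbT.
  have closer z : 0 < P z -> m <= P z -> mdist z (c m) < mdist z p.
    move=> Pz mz; have Pz0 : P z != 0 by rewrite gt_eqF.
    have := @proj_closer _ _ z _ 0 (m / P z) gcI (hP z) in0.
    rewrite c0 mulr0 add0r divfK//; apply; first by rewrite eq_sym.
    by rewrite divr_gt0//= ler_pdivrMr// mul1r.
  have C1 := closer _ P1p m1; have C2 := closer _ P2p m2.
  have in1 : 0 <= w1 <= mdist u v by lra.
  have in2 : 0 <= w2 <= mdist u v by lra.
  have E1 := segment_mdist gb in1 hs; have E2 := segment_mdist gb in2 hs.
  rewrite -/p in E1 E2.
  have E3 := segment_mdist gb in1 in2.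
  have T1 := mdist_triangle_r (b w2) (b w1) (c m).
  have N : `|w1 - w2| = `|w1 - s| + `|w2 - s|.
    by rewrite (distrC w1 w2) (distrC w1 s) !ger0_norm; lra.
  lra.
have mem0 h : curtain_set h `&` a @` `[0, mdist x y]%classic !=set0 ->
    curtain_set h `&` [set w | P w = mdist p q] !=set0.
  by move=> [z [hz [w win awz]]]; exists z; split => //=; rewrite -awz Pa.
case: halves => H.
- have mem h : curtain_set h `&` b @` `[0, s]%classic !=set0 ->
      curtain_set h `&` [set w | P w = 0] !=set0.
    by move=> [z [hz [w win bwz]]]; exists z; split => //=; rewrite -bwz H.
  apply: (L_separated_crossing h1S h2S sep12 gc hP).
  + by apply/mem/meet12; left.
  + by apply/mem/meet12; right.
  + by apply/mem0/meeta; constructor 1.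
  + by apply/mem0/meeta; constructor 2.
- have mem h : curtain_set h `&` b @` `[s, mdist u v]%classic !=set0 ->
      curtain_set h `&` [set w | P w = 0] !=set0.
    by move=> [z [hz [w win bwz]]]; exists z; split => //=; rewrite -bwz H.
  apply: (L_separated_crossing h3S h4S sep34 gc hP).
  + by apply/mem/meet34; left.
  + by apply/mem/meet34; right.
  + by apply/mem0/meeta; constructor 3.
  + by apply/mem0/meeta; constructor 4.
Qed.

End Bottleneck.

(** * Subadditive sequences and sublinear tracking *)

Section Subadditive.
Context {R : realType}.
Variable a : nat -> R.
Hypotheses (a_ge0 : forall n, 0 <= a n) (a0 : a 0%N = 0).
Hypothesis aD : forall m n, a (m + n)%N <= a m + a n.

Lemma subadditive_mul m n : a (m * n)%N <= m%:R * a n.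
Proof.
elim: m => [|m IH]; first by rewrite mul0n mul0r a0.
rewrite mulSn -natr1 mulrDl mul1r addrC; apply: le_trans (aD _ _) _; lra.
Qed.

(** Fekete's lemma, with the infimum of a n / n for tau. *)
Lemma subadditive_rate : exists2 tau, 0 <= tau &
  (forall k, tau * k%:R <= a k) /\
  (forall e, 0 < e -> exists K, forall k, (K <= k)%N -> a k <= (tau + e) * k%:R).
Proof.
pose A := [set a n.+1 / n.+1%:R | n in [set: nat]].
have A0 : lbound A 0 by move=> _ [n _ <-]; rewrite divr_ge0.
have An : A !=set0 by exists (a 1%N / 1%:R); exists 0%N.
have iA : has_inf A by split => //; exists 0.
exists (inf A); first by apply: lb_le_inf.
split=> [[|k]|e e0]; first by rewrite mulr0.
  rewrite -ler_pdivlMr ?ltr0n//; apply: ge_inf; first by exists 0.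
  by exists k.
have [_ [m _ <-] hm] := inf_adherent (divr_gt0 e0 (ltr0n _ 2)) iA.
move: hm; rewrite ltr_pdivrMr ?ltr0n// => hm.
set t := inf A in hm *.
have t0 : 0 <= t by exact: lb_le_inf.
pose K := Num.truncn (m.+1%:R * a 1%N / (e / 2)).
exists K.+1 => k Kk.
have k1 : m.+1%:R * a 1%N <= e / 2 * k%:R.
  rewrite -ler_pdivrMl ?divr_gt0// [leLHS]mulrC.
  apply: (@le_trans _ _ K.+1%:R); last by rewrite ler_nat.
  by apply/ltW/truncnS_gt.
have Ek := divn_eq k m.+1; set q := (k %/ m.+1)%N in Ek.
set r := (k %% m.+1)%N in Ek.
have rm : r%:R <= m.+1%:R :> R by rewrite ler_nat ltnW// ltn_mod.
have h1 : a k <= q%:R * a m.+1 + r%:R * a 1%N.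
  rewrite {1}Ek; apply: le_trans (aD _ _) _; apply: lerD.
    exact: subadditive_mul.
  by have := subadditive_mul r 1%N; rewrite muln1.
have h2 : q%:R * m.+1%:R <= k%:R :> R by rewrite -natrM ler_nat leq_trunc_div.
have h3 : q%:R * a m.+1 <= q%:R * ((t + e / 2) * m.+1%:R).
  by rewrite ler_wpM2l ?ler0n// ltW.
have h4 : (t + e / 2) * (q%:R * m.+1%:R) <= (t + e / 2) * k%:R.
  by rewrite ler_wpM2l//; lra.
have h5 : r%:R * a 1%N <= m.+1%:R * a 1%N by rewrite ler_wpM2r.
lra.
Qed.

(** Record times of the sequence with a slightly smaller linear drift removed;
    they exist since what remains is unbounded. *)
Lemma exists_record_time tau e N : (forall k, tau * k%:R <= a k) -> 0 < e ->
  exists2 n, (N <= n)%N &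
    forall j, (j <= n)%N -> (tau - e) * j%:R <= a n - a (n - j)%N.
Proof.
move=> atau e0; pose b n := a n - (tau - e) * n%:R.
have be n : e * n%:R <= b n by have := atau n; rewrite /b; lra.
pose p n := [forall j : 'I_N.+1, b j < b n].
have pex : exists n, p n.
  pose M := \sum_(j < N.+1) `|b j|.
  exists (Num.truncn (M / e)).+1; apply/forallP => j.
  have bM : b j <= M.
    rewrite /M (bigD1 j)//=; apply: le_trans (ler_norm _) _.
    by rewrite lerDl sumr_ge0.
  apply: le_lt_trans bM _; apply: lt_le_trans (be _).
  by rewrite -ltr_pdivrMl// mulrC truncnS_gt.
case: (ex_minnP pex) => n /forallP pn nmin.
have bn j : (j < n)%N -> b j < b n.
  move=> jn; have [jN|Nj] := leqP j N; first exact: (pn (Ordinal (jN : (j < N.+1)%N))).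
  have : ~~ p j by apply: contraTN jn => /nmin; rewrite -leqNgt.
  by case/forallPn => i; rewrite -leNgt => /le_lt_trans; apply.
exists n.
  rewrite leqNgt; apply/negP => nN.
  by have := pn (Ordinal (ltnW nN : (n < N.+1)%N)); rewrite ltxx.
move=> j jn; have [->|j0] := posnP j; first by rewrite mulr0 subn0 subrr.
have := bn (n - j)%N (ltac:(lia)); rewrite /b natrB//; lra.
Qed.

End Subadditive.

Section Tracking.
Context {R : realType} {X : metricType R}.
Hypothesis X_CAT0 : CAT0 X.
Implicit Types (x y : X) (b c : R -> X) (z : nat -> X).

(** By Stewart's theorem, an excess e in the triangle inequality puts w at a
    distance of order the square root of e from the segment. *)
Lemma near_degenerate_triangle x y (w : X) c e : geodesic_segment x y c ->
  0 <= e -> mdist x w + mdist w y <= mdist x y + e ->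
  mdist w (c (Num.min (mdist x w) (mdist x y))) ^+ 2 <=
    2 * e * mdist x w + e ^+ 2.
Proof.
move=> gc e0 uv; have [u0 v0 d0] := And3 (mdist_ge0 x w) (mdist_ge0 w y) (mdist_ge0 x y).
have eu : 0 <= e * mdist x w by rewrite mulr_ge0.
have [du|ud] := ltP (mdist x y) (mdist x w).
  have [_ _ ->] := gc.
  have : mdist w y ^+ 2 <= e ^+ 2.
    by rewrite lerXn2r ?nnegrE//; lra.
  lra.
have [d00|dn0] := eqVneq (mdist x y) 0.
  have u00 : mdist x w = 0 by apply/le_anti; rewrite u0 -d00 ud.
  have [_ c0 _] := gc; rewrite u00 c0 (metric_sym w) u00.
  by rewrite expr0n/= mulr0 add0r sqr_ge0.
have dp : 0 < mdist x y by rewrite lt_def dn0.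
have := @CAT0_stewart _ _ X_CAT0 _ _ w _ (mdist x w) gc.
rewrite u0 ud => /(_ isT); rewrite (metric_sym w x).
set u := mdist x w in u0 uv ud eu *; set v := mdist w y in v0 uv *.
set d := mdist x y in uv ud d0 dp *; set D := mdist _ _ => h.
have h2 : v ^+ 2 <= (d - u + e) ^+ 2 by rewrite lerXn2r ?nnegrE//; lra.
have h3 : u * v ^+ 2 <= u * (d - u + e) ^+ 2 by rewrite ler_wpM2l.
rewrite -(ler_pM2l dp); apply: le_trans h _.
have h4 : 0 <= u * (e * u) by rewrite mulr_ge0.
have h5 : u * e ^+ 2 <= d * e ^+ 2 by rewrite ler_wpM2r// sqr_ge0.
nra.
Qed.

Definition spaced (a : nat -> R) z :=
  forall i j, (i <= j)%N -> mdist (z i) (z j) = a (j - i)%N.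

(** Karlsson and Margulis: an orbit with positive drift stays sublinearly close
    to the geodesics that join its points.  At a record time n the triangle with
    vertices z_0, z_k, z_n is nearly degenerate for all large k up to n, hence
    z_k and z_N are both close to the segment from z_0 to z_n; contracting
    towards z_0 moves that segment to the one from z_0 to z_N. *)
Lemma sublinear_tracking (a : nat -> R) tau delta :
  (forall n, 0 <= a n) ->
  (forall k, tau * k%:R <= a k) ->
  (forall e, 0 < e -> exists K, forall k, (K <= k)%N -> a k <= (tau + e) * k%:R) ->
  0 < tau -> 0 < delta ->
  exists K, forall z b k N, spaced a z -> (K <= k <= N)%N ->
    geodesic_segment (z 0%N) (z N) b ->
    exists2 t, 0 <= t <= a N & mdist (z k) (b t) <= delta * k%:R.
Proof.
move=> a_ge0 atau arate tau0 delta0.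
pose eta := Num.min (delta / 6) (tau / 4).
have eta0 : 0 < eta by rewrite lt_min !divr_gt0.
have [eta_d eta_t] : 6 * eta <= delta /\ 4 * eta <= tau.
  have : eta <= delta / 6 by rewrite /eta ge_min lexx.
  have : eta <= tau / 4 by rewrite /eta ge_min lexx orbT.
  lra.
pose e := eta ^+ 2 / (6 * tau).
have eE : 6 * tau * e = eta ^+ 2.
  by rewrite /e mulrC divfK// gt_eqF// mulr_gt0.
have e0 : 0 < e by rewrite divr_gt0 ?exprn_gt0 ?mulr_gt0.
clearbody e.
have e_eta : 24 * e <= eta.
  by rewrite -(ler_pM2l tau0); nra.
have [K hK] := arate e e0; exists K.+1 => z b k N hz /andP[Kk kN] gb.
have [n Nn rec] := exists_record_time N atau e0.
have [c gc] := X_CAT0.1 (z 0%N) (z n).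
have dz i : mdist (z 0%N) (z i) = a i by rewrite hz// subn0.
have close i : (K <= i <= n)%N ->
    mdist (z i) (c (Num.min (a i) (a n))) <= eta * i%:R.
  move=> /andP[Ki lin]; have i0 : 0 <= i%:R :> R by [].
  have ai := hK i Ki; have an := rec i lin.
  have ei := mulr_ge0 (ltW e0) i0; have e2 : 0 <= 2 * e * i%:R by lra.
  have uv : mdist (z 0%N) (z i) + mdist (z i) (z n) <=
      mdist (z 0%N) (z n) + 2 * e * i%:R by rewrite !dz hz//; lra.
  have := near_degenerate_triangle gc e2 uv; rewrite !dz => h.
  rewrite -ler_sqr ?nnegrE ?mdist_ge0 ?mulr_ge0 ?(ltW eta0)//.
  apply: le_trans h _; rewrite !exprMn -eE.
  have h1 : e * i%:R * a i <= e * i%:R * ((tau + e) * i%:R).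
    by rewrite ler_wpM2l.
  have h2 : 0 <= (e * (tau - 4 * e)) * i%:R ^+ 2.
    rewrite mulr_ge0 ?sqr_ge0// mulr_ge0 ?(ltW e0)//; lra.
  nra.
have kn := leq_trans kN Nn.
have k0 : 0 < k%:R :> R by rewrite ltr0n; exact: leq_trans Kk.
have kNR : k%:R <= N%:R :> R by rewrite ler_nat.
pose s i := Num.min (a i) (a n).
have sin i : 0 <= s i <= a n by rewrite /s le_min !a_ge0 ge_min lexx orbT.
have sin' i : 0 <= s i <= mdist (z 0%N) (z n) by rewrite dz.
have hk : mdist (z k) (c (s k)) <= eta * k%:R by apply: close; rewrite kn ltnW.
have hN : mdist (z N) (c (s N)) <= eta * N%:R.
  by apply: close; rewrite Nn (leq_trans (ltnW Kk)).
have sk : s k <= (tau + e) * k%:R.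
  by apply: (@le_trans _ _ (a k)); [rewrite /s ge_min lexx | exact/hK/ltnW].
have sN : (tau - eta) * N%:R <= s N.
  have := metric_triangle (z 0%N) (c (s N)) (z N).
  rewrite dz (segment_mdistl gc (sin' N)) (metric_sym _ (z N)).
  have := atau N; lra.
have N0 : 0 < N%:R :> R by lra.
have sN34 : 3 * tau * N%:R <= 4 * s N by nra.
have sk54 : 4 * s k <= 5 * tau * k%:R by nra.
have [skN|sNk] := leP (s k) (s N).
  have sN0 : 0 < s N by have := mulr_gt0 tau0 N0; lra.
  have gw := segment_prefix gc (sin' N).
  pose l := s k / s N.
  have l01 : 0 <= l <= 1.
    by rewrite divr_ge0 ?(ltW sN0)//= ?ler_pdivrMr ?mul1r//; case/andP: (sin k).
  have lN : l * N%:R <= 2 * k%:R.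
    rewrite /l mulrAC ler_pdivrMr//.
    have h := mulr_ge0 (mulr_ge0 (ltW tau0) (ltW k0)) (ltW N0).
    nra.
  have := CAT0_fan X_CAT0 gb gw l01.
  rewrite dz (segment_mdistl gc (sin' N)) /l divfK ?gt_eqF// -/l => h.
  exists (l * a N).
    by case/andP: l01 => l0 l1; rewrite mulr_ge0//= ler_piMl.
  have := mdist_triangle_r (b (l * a N)) (z k) (c (s k)).
  have : l * mdist (z N) (c (s N)) <= l * (eta * N%:R).
    by case/andP: l01 => l0 _; rewrite ler_wpM2l.
  have : eta * (l * N%:R) <= eta * (2 * k%:R) by rewrite ler_pM2l.
  have : 6 * eta * k%:R <= delta * k%:R by rewrite ler_pM2r.
  have : 0 <= eta * k%:R by rewrite mulr_ge0 ?ltW.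
  lra.
exists (a N); first by rewrite a_ge0 lexx.
have -> : b (a N) = z N by have [_ _] := gb; rewrite dz.
have Nk : N%:R <= 2 * k%:R :> R by rewrite -(ler_pM2l tau0); nra.
have T1 := metric_triangle (z k) (c (s k)) (z N).
have T2 := metric_triangle (c (s k)) (c (s N)) (z N).
have T3 := segment_mdist gc (sin' k) (sin' N).
rewrite ger0_norm in T3; last lra.
rewrite (metric_sym (c (s N)) (z N)) in T2.
have h1 : eta * N%:R <= eta * (2 * k%:R) by rewrite ler_pM2l.
have h2 : (tau - eta) * k%:R <= (tau - eta) * N%:R by rewrite ler_wpM2l//; lra.
have h3 : 24 * e * k%:R <= eta * k%:R by rewrite ler_pM2r.
have h4 : 6 * eta * k%:R <= delta * k%:R by rewrite ler_pM2r.
have h5 : 0 <= eta * k%:R by rewrite mulr_ge0 ?ltW.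
have h6 : 0 <= e * k%:R by rewrite mulr_ge0 ?ltW.
lra.
Qed.

End Tracking.

(** * Isometries acting on chains; absence of backtracking *)

Section PushChains.
Context {R : realType} {X : metricType R}.
Variables (f f' : X -> X).
Hypotheses (fK : cancel f f') (f'K : cancel f' f).
Hypothesis f_isom : forall x y, mdist (f x) (f y) = mdist x y.
Implicit Types (h k : curtain X) (A B : set X).

Let pushf := push f_isom.

Lemma separates_push h A B : separates h (f @^-1` A) (f @^-1` B) ->
  separates (pushf h) A B.
Proof.
have key (C : set X) J : f @^-1` C `<=` proj_preimage (curtain_dom h)
    (curtain_geo h) J -> C `<=` proj_preimage (curtain_dom h)
    (f \o curtain_geo h) J.
  by move=> CJ u Cu; rewrite (push_preimage fK f'K f_isom)/=; apply: CJ;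
    rewrite /= f'K.
by move=> [[hA hB]|[hA hB]]; [left|right]; split; exact: key.
Qed.

Lemma preimage_curtain_set_push h :
  f @^-1` curtain_set (pushf h) = curtain_set h.
Proof.
by rewrite (curtain_set_push fK f'K); apply/seteqP; split => u /=; rewrite fK.
Qed.

Lemma chain_push n (c : 'I_n -> curtain X) : chain c ->
  chain (fun i => pushf (c i)).
Proof.
move=> [ci cs]; split=> [i j E|i j k ji kj].
  apply: ci; rewrite /= -(preimage_curtain_set_push (c i)) [in LHS]E.
  exact: preimage_curtain_set_push.
by apply: separates_push; rewrite !preimage_curtain_set_push; exact: cs.
Qed.

End PushChains.

Section PushSeparated.
Context {R : realType} {X : metricType R}.
Variables (f f' : X -> X).
Hypotheses (fK : cancel f f') (f'K : cancel f' f).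
Hypothesis f_isom : forall x y, mdist (f x) (f y) = mdist x y.
Implicit Types (h k : curtain X).

Let pushf := push f_isom.

Lemma L_separated_push L h k : L_separated L h k ->
  L_separated L (pushf h) (pushf k).
Proof.
have f'_isom := inv_isom f'K f_isom.
move=> [dis sep]; split.
  apply/seteqP; split => // u; rewrite !(curtain_set_push fK f'K) => -[hu ku].
  by suff : (curtain_set h `&` curtain_set k) (f' u) by rewrite dis.
move=> n c cc cm.
apply: (sep n (fun i => push f'_isom (c i)) (chain_push f'K fK f'_isom cc)).
have key (l m : curtain X) : Defs.meets l (pushf m) ->
    Defs.meets (push f'_isom l) m.
  move=> [u [lu]]; rewrite (curtain_set_push fK f'K) => mu.
  by exists (f' u); rewrite (curtain_set_push f'K fK)/= f'K.
by move=> i; have [m1 m2] := cm i; split; exact: key.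
Qed.

Lemma L_chain_cards_push L x y n : L_chain_cards L x y n ->
  L_chain_cards L (f x) (f y) n.
Proof.
have fset1 u : f @^-1` [set f u] = [set u].
  by apply/seteqP; split => v /= [] // E; rewrite ?E// -(fK v) E fK.
move=> [c [[cc cL] cxy]]; exists (fun i => pushf (c i)); split.
  split; first exact: (chain_push fK f'K).
  by move=> i j ij; apply: L_separated_push; exact: cL.
by move=> i; apply: (separates_push fK f'K); rewrite !fset1; exact: cxy.
Qed.

End PushSeparated.

Section Invariance.
Context {R : realType} {X : metricType R}.
Variables (f f' : X -> X).
Hypotheses (fK : cancel f f') (f'K : cancel f' f).
Hypothesis f_isom : forall x y, mdist (f x) (f y) = mdist x y.

Lemma L_dist_isom L x y : L_dist L (f x) (f y) = L_dist L x y.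
Proof.
rewrite /L_dist (can_eq fK).
have -> // : L_chain_cards L (f x) (f y) = L_chain_cards L x y.
apply/seteqP; split => n; last exact: (L_chain_cards_push fK f'K).
have f'_isom := inv_isom f'K f_isom.
by move=> /(L_chain_cards_push f'K fK f'_isom); rewrite !fK.
Qed.

Lemma can_iter n : cancel (iter n f) (iter n f').
Proof. by elim: n => // n IH x; rewrite iterSr [iter n.+1 f x]iterS fK. Qed.

Lemma isom_iter n x y : mdist (iter n f x) (iter n f y) = mdist x y.
Proof. by elim: n => //= n IH; rewrite f_isom. Qed.

End Invariance.

Section Backtracking.
Context {R : realType} {X : metricType R}.
Hypothesis X_CAT0 : CAT0 X.
Implicit Types (x y : X) (z : nat -> X) (h : nat -> curtain X) (S : nat -> X -> R).

Lemma nested_opp (S T : X -> R) : nested S T ->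
  nested (fun u => - T u) (fun u => - S u).
Proof. by move=> ST u Tu; have := @nested_gt _ _ _ _ u ST; lra. Qed.

Lemma L_tower_rev L n h S : L_tower L n h S ->
  L_tower L n (fun i => h (n - i.+1)%N) (fun i u => - S (n - i.+1)%N u).
Proof.
move=> [[hS SS] hL]; split; first split=> [i lin|i j ij].
- by apply: is_side_opp; apply: hS; lia.
- by apply: nested_opp; apply: SS; lia.
by move=> i j lin jn ij; apply: hL; lia.
Qed.

Lemma L_tower_le L m n h S : (m <= n)%N -> L_tower L n h S -> L_tower L m h S.
Proof.
move=> mn [[hS SS] hL]; split; first split=> [i im|i j /andP[ij jm]].
- exact: hS (leq_trans im mn).
- by apply: SS; rewrite ij (leq_trans jm).
by move=> i j im jm; apply: hL; exact: leq_trans mn.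
Qed.

(** The bottleneck property at the third last curtain, which has two L-separated
    curtains on either side; the d + 2 curtains before it keep it far from x. *)
Lemma tower_fellow_travel L d h S x y y' (a b : R -> X) :
  L_tower L d.+4.+1 h S -> tower_separates d.+4.+1 S x y ->
  tower_separates d.+4.+1 S x y' ->
  geodesic_segment x y a -> geodesic_segment x y' b ->
  exists s t, [/\ d%:R < s <= mdist x y', 0 <= t <= mdist x y &
    mdist (b s) (a t) <= L.+1%:R].
Proof.
move=> [[hS SS] hL] Sy Sy' ga gb; have [gbI b0 bd] := gb.
have d2 : (d.+2 < d.+4.+1)%N by rewrite !ltnS leqW.
have [|s sin Ss] := segment_level (c := 0) (hS _ d2) gb.
  by have := Sy' _ d2; lra.
have Sbefore i : (i < d.+2)%N -> 2^-1 < S i (b s).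
  move=> id; apply: (@nested_gt _ _ (S i) (S d.+2)).
    by apply: SS; rewrite id d2.
  by rewrite Ss; lra.
have Safter i : (d.+2 < i < d.+4.+1)%N -> S i (b s) < - 2^-1.
  by move=> /SS Sd; apply: Sd; rewrite Ss; lra.
have dxs := segment_mdistl gb sin.
have long : d.+2%:R <= s.
  rewrite -dxs; apply: (tower_mdist X_CAT0 (L_tower_le (ltnW d2) (conj (conj hS SS) hL)).1).
  by move=> i id; split; [case: (Sy' i (ltn_trans id d2)) | exact: Sbefore].
have in0 : `[0, mdist x y']%classic 0 by rewrite /= in_itv/= lexx mdist_ge0.
have ins : `[0, mdist x y']%classic s by rewrite /= in_itv.
have ind : `[0, mdist x y']%classic (mdist x y').
  by rewrite /= in_itv/= lexx mdist_ge0.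
have band i u : (i < d.+4.+1)%N -> S i u = 0 -> curtain_set (h i) u.
  by move=> id Su; rewrite (side_setE (hS i id))/= Su; lra.
have [s0 sd] := andP sin.
have mb1 i : (i < d.+2)%N -> curtain_set (h i) `&` b @` `[0, s]%classic !=set0.
  move=> id; have id' := ltn_trans id d2.
  have [|r rin Sr] := geodesic_level (c := 0) (hS i id') gbI in0 ins s0.
    by rewrite b0; have := Sy' i id'; have := Sbefore i id; lra.
  exists (b r); split; first exact: band.
  by exists r; rewrite /= ?in_itv.
have mb2 i : (d.+2 < i < d.+4.+1)%N ->
    curtain_set (h i) `&` b @` `[s, mdist x y']%classic !=set0.
  move=> id; have /andP[_ id'] := id.
  have [|r rin Sr] := geodesic_level (c := 0) (hS i id') gbI ins ind sd.
    by rewrite bd; have := Safter i id; have := Sy' i id'; lra.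
  exists (b r); split; first exact: band.
  by exists r; rewrite /= ?in_itv.
have ma i : (i < d.+4.+1)%N ->
    curtain_set (h i) `&` a @` `[0, mdist x y]%classic !=set0.
  move=> id; have [|r rin Sr] := segment_level (c := 0) (hS i id) ga.
    by have := Sy i id; lra.
  exists (a r); split; first exact: band.
  by exists r; rewrite /= ?in_itv.
have i0 : (d < d.+4.+1)%N by rewrite !ltnS !leqW.
have i1 : (d.+1 < d.+4.+1)%N by rewrite !ltnS !leqW.
have i3 : (d.+3 < d.+4.+1)%N by rewrite !ltnS.
have i4 : (d.+4 < d.+4.+1)%N by rewrite !ltnS.
have sep12 := hL _ _ i0 i1 (negbT (ltn_eqF (ltnSn d))).
have sep34 := hL _ _ i3 i4 (negbT (ltn_eqF (ltnSn d.+3))).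
have [||| t tin tclose] := bottleneck X_CAT0 ga gb sin (hS _ i0) (hS _ i1)
    (hS _ i3) (hS _ i4) sep12 sep34.
- by move=> _ [->|->]; apply: mb1; rewrite !ltnS ?leqnSn.
- by move=> _ [->|->]; apply: mb2; rewrite !ltnS ?leqnn ?leqnSn.
- by move=> _ [->|->|->|->]; apply: ma.
exists s, t; split => //; rewrite sd andbT; apply: lt_le_trans long.
by rewrite ltr_nat.
Qed.

Variables (a : nat -> R) (tau : R).
Hypotheses (a_ge0 : forall n, 0 <= a n) (a0 : a 0%N = 0).
Hypothesis aD : forall m n, a (m + n)%N <= a m + a n.
Hypotheses (tau0 : 0 < tau) (a_tau : forall k, tau * k%:R <= a k).
Hypothesis a_rate :
  forall e, 0 < e -> exists K, forall k, (K <= k)%N -> a k <= (tau + e) * k%:R.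

(** The forward orbit crosses the tower, so the geodesic to z_N does.  If the
    backward orbit crossed many of its curtains as well, the two geodesics from
    the common base point would be close together for a long time, by the
    bottleneck property.  So would z_k and z'_k for some k proportional to L, by
    sublinear tracking, whereas their distance is at least 2 * tau * k. *)
Lemma no_backtracking : exists A B : nat, forall L n h S z z' N c,
  spaced a z -> spaced a z' -> z' 0%N = z 0%N ->
  (forall k, mdist (z k) (z' k) = a (k + k)%N) ->
  L_tower L n h S -> tower_separates n S (z 0%N) (z N) -> (c < n)%N ->
  - 2^-1 <= S c (z' N) -> (c < A * L + B)%N.
Proof.
pose delta := tau / 4; have delta0 : 0 < delta by rewrite divr_gt0.
have [K hK] := sublinear_tracking X_CAT0 a_ge0 a_tau a_rate tau0 delta0.
pose q := (Num.truncn (4 / tau)).+1.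
pose p := (Num.truncn (a 1%N + delta)).+1.
have tq : 4 <= tau * q%:R.
  by rewrite -ler_pdivrMl// mulrC ltW// truncnS_gt.
have ap : a 1%N + delta <= p%:R by rewrite ltW// truncnS_gt.
exists (p * q + 1)%N, (p * (K + q) + 8)%N => L n h S z z' N c hz hz' zz' zk.
move=> hT Sx cn Sc; rewrite ltnNge; apply/negP => cbig.
pose k := (K + q * L.+1)%N.
have [d cd dk] : exists2 d, c = d.+4.+1 & (p * k <= d)%N.
  by exists (c - 5)%N; rewrite /k; lia.
have Kk : (K <= k)%N by rewrite leq_addr.
have tk : 4 * L.+1%:R <= tau * k%:R.
  have l0 : 0 <= L.+1%:R :> R by [].
  have K0 : 0 <= K%:R :> R by [].
  rewrite /k natrD natrM.
  have := ler_wpM2r l0 tq; have := mulr_ge0 (ltW tau0) K0; lra.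
clearbody k; clear cbig; set x := z 0%N in Sx zz'.
have Sz' i : (i < c)%N -> 2^-1 < S i (z' N).
  move=> ic; apply: (@nested_gt _ _ (S i) (S c)) => //.
  by apply: hT.1.2; rewrite ic.
have Sx' i : (i < c)%N -> S i x < - 2^-1 /\ 2^-1 < S i (z N).
  by move=> ic; exact: Sx i (ltn_trans ic cn).
have dz' i : mdist x (z' i) = a i by rewrite -zz' hz'// subn0.
have dz i : mdist x (z i) = a i by rewrite hz// subn0.
have [b gb] := X_CAT0.1 x (z' N); have [al ga] := X_CAT0.1 x (z N).
have [|||s [t [/andP[sd s1] tin tclose]]] := @tower_fellow_travel L d h S _ _ _ al b
  _ _ _ ga gb.
- by apply: L_tower_le hT; rewrite -cd ltnW.
- by move=> i; rewrite -cd; exact: Sx'.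
- by move=> i; rewrite -cd => ic; split; [case: (Sx' i ic) | exact: Sz'].
have long : d%:R <= s by exact: ltW.
have sp : 0 < s by apply: le_lt_trans sd.
have sin : 0 <= s <= mdist x (z' N) by rewrite s1 ltW.
have dxs := segment_mdistl gb sin.
clear Sz' Sx' Sx Sc hT cn cd.
have dxt := segment_mdistl ga tin.
have a1 : 0 < a 1%N.
  by apply: lt_le_trans tau0 _; have := a_tau 1%N; rewrite mulr1.
have ak i : a i <= i%:R * a 1%N.
  by have := subadditive_mul a0 aD i 1%N; rewrite muln1.
have k0 : 0 <= k%:R :> R by [].
have ks : (a 1%N + delta) * k%:R <= s.
  apply: (le_trans _ long); apply: (@le_trans _ _ (p%:R * k%:R)).
    by rewrite ler_wpM2r.
  by rewrite -natrM ler_nat.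
have kN : (K <= k <= N)%N.
  rewrite Kk leqNgt; apply/negP => Nk.
  have NkR : N.+1%:R <= k%:R :> R by rewrite ler_nat.
  rewrite -natr1 in NkR.
  have : N%:R * a 1%N < k%:R * a 1%N by rewrite ltr_pM2r//; lra.
  have := ak N; rewrite -dz' => h1.
  have : 0 <= delta * k%:R by rewrite mulr_ge0// ltW.
  lra.
have [r rin rclose] := hK z al k N hz kN ga.
have gb' : geodesic_segment (z' 0%N) (z' N) b by rewrite zz'.
have [r' rin' rclose'] := hK z' b k N hz' kN gb'.
rewrite -(dz N) in rin; rewrite -(dz' N) in rin'.
have dxr := segment_mdistl ga rin; have dxr' := segment_mdistl gb rin'.
have r'a : `|r' - a k| <= delta * k%:R.
  rewrite -dxr' -(dz' k) ler_norml.
  have := metric_triangle x (z' k) (b r'); have := mdist_triangle_r (z' k) x (b r').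
  lra.
have ra : `|r - a k| <= delta * k%:R.
  rewrite -dxr -(dz k) ler_norml.
  have := metric_triangle x (z k) (al r); have := mdist_triangle_r (z k) x (al r).
  lra.
move: ra r'a; rewrite !ler_norml => ra r'a.
have r's : r' <= s by have := ak k; lra.
(* the point of the segment from x to al t that corresponds to b r' *)
pose l := r' / s.
have ls : l * s = r' by rewrite /l divfK// gt_eqF.
have l01 : 0 <= l <= 1.
  by case/andP: rin' => r0 _; rewrite /l divr_ge0 ?(ltW sp)//= ler_pdivrMr// mul1r.
have [l0 l1] := andP l01.
have := CAT0_fan X_CAT0 (segment_prefix gb sin) (segment_prefix ga tin) l01.
rewrite dxs dxt ls => fan.
have tclose' : l * mdist (b s) (al t) <= L.+1%:R.
  by apply: le_trans tclose; rewrite ler_piMl// mdist_ge0.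
have st : `|s - t| <= L.+1%:R.
  rewrite -dxs -dxt ler_norml.
  have := metric_triangle x (b s) (al t); have := mdist_triangle_r (b s) x (al t).
  lra.
have lst : `|r' - l * t| <= L.+1%:R.
  rewrite -ls -mulrBr normrM (ger0_norm l0); apply: le_trans st.
  by rewrite ler_piMl.
have ltin : 0 <= l * t <= mdist x (z N).
  case/andP: tin => t0 t1; rewrite mulr_ge0//=; apply: le_trans t1.
  by rewrite ler_piMl.
have E := segment_mdist ga rin ltin.
have E' : `|r - l * t| <= 2 * delta * k%:R + L.+1%:R.
  by move: lst; rewrite !ler_norml; lra.
have T1 := metric_triangle (z k) (al r) (z' k).
have T2 := metric_triangle (al r) (al (l * t)) (z' k).
have T3 := metric_triangle (al (l * t)) (b r') (z' k).
rewrite (metric_sym (b r') (z' k)) (metric_sym (al (l * t)) (b r')) in T3.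
have := a_tau (k + k)%N; rewrite -zk natrD.
have : 4 * (delta * k%:R) = tau * k%:R by rewrite /delta; field.
have : 1 <= L.+1%:R :> R by rewrite ler1n.
lra.
Qed.

End Backtracking.

(** * Skewering *)

Section Skewering.
Context {R : realType} {X : metricType R}.
Hypothesis X_CAT0 : CAT0 X.
Implicit Types (x y : X) (h : nat -> curtain X) (S T : X -> R).

(** If f' is the inverse of an isometry f, then S \o f' is the signed coordinate of
    the image under f of the curtain with coordinate S. *)
Definition skewers L (f f' : X -> X) x := exists (h k : curtain X) S T,
  [/\ is_side h S, is_side k T & L_separated L h k] /\
  [/\ nested S T, nested T (S \o f'), S x < - 2^-1 & 2^-1 < S (f x)].

Lemma curtain_connected (k : curtain X) : connected (curtain_set k).
Proof.
have [k' [S [kS <- _ _]]] := exists_side_truncation X_CAT0 k.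
by rewrite (side_setE kS); exact: side_connected kS.
Qed.

Section Iterates.
Variables (f f' : X -> X).
Hypotheses (fK : cancel f f') (f'K : cancel f' f).
Hypothesis f_isom : forall x y, mdist (f x) (f y) = mdist x y.

(** The translates of the first skewered curtain form an L-chain: a curtain
    meeting two of them also meets the translate of the second skewered curtain
    in between. *)
Lemma skewers_L_chain L x n : skewers L f f' x ->
  L_chain_cards L x (iter n f x) n.
Proof.
move=> [h [k [S [T [[hS kT sep] [ST TS Sx Sfx]]]]]].
have iK i := can_iter fK i; have iK' i := can_iter f'K i.
pose H i := push (isom_iter f_isom i) h.
have HS i : is_side (H i) (S \o iter i f').
  exact: (is_side_push (iK i) (iK' i)).
have KT i : is_side (push (isom_iter f_isom i) k) (T \o iter i f').
  exact: (is_side_push (iK i) (iK' i)).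
have tow m : tower m H (fun i => S \o iter i f').
  apply: tower_consecutive => // i _ u /ST Tu.
  by apply: (TS (iter i f' u)); lra.
have sepH i j : (i < j)%N -> L_separated L (H i) (H j).
  move=> ij; split.
    by apply: (nested_disjoint (HS i) (HS j)); apply: (tow j.+1).2; rewrite ij ltnS leqnn.
  have [_ sep'] := L_separated_push (iK i) (iK' i) (isom_iter f_isom i) sep.
  move=> m c cc cm; apply: (sep' m c cc) => l; have [m1 m2] := cm l.
  split; first exact: m1.
  have [u [cu hu]] := m1; have [v [cv hv]] := m2.
  rewrite /Defs.meets setIC.
  rewrite (side_setE (HS i)) in hu; rewrite (side_setE (HS j)) in hv.
  apply: (connected_crosses (KT i) (@curtain_connected (c l)) cu cv).
    by apply: ST; move: hu => /=; lra.
  have TSij : nested (T \o iter i f') (S \o iter j f').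
    have TSi : nested (T \o iter i f') (S \o iter i.+1 f').
      by move=> w Tw; exact: (TS (iter i f' w)).
    move: ij; rewrite leq_eqVlt => /predU1P[<- //|ij].
    apply: nested_trans TSi _ => w Sw.
    by apply: ((tow j.+1).2 i.+1 j _ w Sw); rewrite ij ltnS leqnn.
  by apply: (nested_gt TSij); move: hv => /=; lra.
have Sf m : 2^-1 < S (iter m.+1 f x).
  elim: m => // m IH; apply: (@nested_gt _ _ S (S \o f')).
    by apply: nested_trans TS.
  by rewrite /= fK; move: IH => /=; lra.
exists (fun i => H i); split; first split.
- exact: (tower_chain (tow n)).
- move=> i j; rewrite neq_ltn => /orP[|] ij; first exact: sepH.
  by apply/L_separated_sym/sepH.
move=> i; apply: (side_separates (HS i)) => _ ->.
  have [i0|i0] := posnP (val i); first by rewrite /= i0.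
  apply: (nested_lt (_ : nested S _) Sx).
  by apply: ((tow i.+1).2 0%N i); rewrite i0 ltnS leqnn.
have -> : iter n f x = iter i f (iter (n - i)%N f x).
  by rewrite -iterD subnKC// ltnW.
rewrite /= iK; have := ltn_ord i; rewrite -subn_gt0.
by case: (n - i)%N.
Qed.

End Iterates.

Variables (g g' : X -> X).
Hypotheses (gK : cancel g g') (g'K : cancel g' g).
Hypothesis g_isom : forall x y, mdist (g x) (g y) = mdist x y.

Let g'_isom := inv_isom g'K g_isom.

Lemma iter_inv_mdist n x y : mdist x (iter n g' y) = mdist (iter n g x) y.
Proof. by rewrite -(isom_iter g_isom n) (can_iter g'K). Qed.

Lemma orbit_spaced (a : nat -> R) y : (forall n, mdist y (iter n g y) = a n) ->
  [/\ spaced a (fun i => iter i g y), spaced a (fun i => iter i g' y) &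
    forall k, mdist (iter k g y) (iter k g' y) = a (k + k)%N].
Proof.
move=> ya; have ya' n : mdist y (iter n g' y) = a n.
  by rewrite iter_inv_mdist metric_sym.
split=> [i j ij|i j ij|k]; last by rewrite iter_inv_mdist -iterD metric_sym.
  by rewrite -{1}(subnKC ij) iterD (isom_iter g_isom).
by rewrite -{1}(subnKC ij) iterD (isom_iter g'_isom).
Qed.

Variables (x : X) (tau : R).
Let a n := mdist x (iter n g x).

Lemma orbit_aD m n : a (m + n)%N <= a m + a n.
Proof.
rewrite /a iterD; apply: (le_trans (metric_triangle _ (iter m g x) _)).
by rewrite (isom_iter g_isom).
Qed.

Hypotheses (tau0 : 0 < tau) (a_tau : forall k, tau * k%:R <= a k).
Hypothesis a_rate :
  forall e, 0 < e -> exists K, forall k, (K <= k)%N -> a k <= (tau + e) * k%:R.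

(** Let f be the N-th power of g and let the curtains be ordered from x to f x.
    By the absence of backtracking, the middle ones also separate the inverse
    image of x from f (f x).  Not all of the images under f of L + 1 of them can
    meet the next two, which are L-separated; an image disjoint from one of these
    two lies beyond it. *)
Lemma exists_skewers : exists A B : nat, forall L N n,
  L_chain_cards L x (iter N g x) n -> (A * L + B <= n)%N ->
  skewers L (iter N g) (iter N g') x.
Proof.
have a_ge0 n : 0 <= a n by exact: mdist_ge0.
have a0 : a 0%N = 0 by rewrite /a mdistxx.
have [A [B noback]] := no_backtracking X_CAT0 a_ge0 a0 orbit_aD tau0 a_tau a_rate.
exists (A + A + 1)%N, (B + B + 4)%N => L N n [c [cL cxy]] nbig.
pose C := (A * L + B)%N.
have {}nbig : (C + C + L + 4 <= n)%N by rewrite /C; lia.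
have n0 : (0 < n)%N by lia.
set f := iter N g; set f' := iter N g'; set y := f x.
have fK : cancel f f' by exact: can_iter gK N.
have f'K : cancel f' f by exact: can_iter g'K N.
have f_isom : forall u v, mdist (f u) (f v) = mdist u v by exact: isom_iter.
have [h [S [hT Sxy]]] := L_chain_tower X_CAT0 n0 cL cxy.
have [[hS SS] hL] := hT.
have back i : (C <= i < n)%N -> S i (f' x) < - 2^-1.
  have ya k : mdist x (iter k g x) = a k by [].
  have [z1 z2 z3] := orbit_spaced ya.
  move=> /andP[Ci lin]; rewrite ltNge; apply/negP => Si.
  by have := noback L n h S _ _ N i z1 z2 erefl z3 hT Sxy lin Si; lia.
have forth i : (i < n - C)%N -> 2^-1 < S i (f y).
  have ya k : mdist y (iter k g y) = a k.
    by rewrite /y /f -iterD addnC iterD (isom_iter g_isom).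
  have [z1 z2 z3] := orbit_spaced ya.
  have z3' k : mdist (iter k g' y) (iter k g y) = a (k + k)%N.
    by rewrite metric_sym.
  move=> lin; rewrite ltNge; apply/negP => Si.
  have hT' := L_tower_rev hT.
  have Syx : tower_separates n (fun i u => - S (n - i.+1)%N u) (iter 0 g' y)
      (iter N g' y).
    have -> : iter N g' y = x by rewrite -[iter N g' y]/(f' y) /y fK.
    move=> j jn /=; have [|S1 S2] := Sxy (n - j.+1)%N _; first by lia.
    by rewrite -/y; lra.
  have := noback L n _ _ _ _ N (n - i.+1)%N z2 z1 erefl z3' hT' Syx.
  have -> : (n - (n - i.+1).+1)%N = i by lia.
  by rewrite -/f => /(_ ltac:(lia) ltac:(lra)); lia.
pose b0 := (C + L.+1)%N.
have bn : (b0.+1 < n - C)%N by rewrite /b0; lia.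
have [i [b [iC bb dis]]] : exists i b, [/\ (C <= i < b0)%N,
    b = b0 \/ b = b0.+1 &
    forall u, curtain_set (h b) u -> ~ curtain_set (push f_isom (h i)) u].
  apply: contrapT => none.
  have inn (j : nat) : (j < L.+1)%N -> (C + j < n)%N by lia.
  have tow : tower L.+1 (fun j => push f_isom (h (C + j)%N))
      (fun j => S (C + j)%N \o f').
    split=> [j jL|j l /andP[jl lL] u]; first exact/(is_side_push fK f'K)/hS/inn.
    by apply: SS; rewrite ltn_add2l jl inn.
  have [_ sep] : L_separated L (h b0) (h b0.+1) by apply: hL; lia.
  suff /(sep _ _ (tower_chain tow)) : forall j : 'I_L.+1,
      Defs.meets (push f_isom (h (C + j)%N)) (h b0) /\
      Defs.meets (push f_isom (h (C + j)%N)) (h b0.+1) by rewrite ltnn.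
  move=> j; have jL := ltn_ord j.
  have meet b : b = b0 \/ b = b0.+1 ->
      Defs.meets (push f_isom (h (C + j)%N)) (h b).
    move=> bb; apply/set0P/eqP => E; apply: none.
    exists (C + j)%N, b; split => //; first by rewrite leq_addr ltn_add2l.
    move=> u hbu hju.
    by suff : (curtain_set (push f_isom (h (C + j)%N)) `&` curtain_set (h b)) u
      by rewrite E.
  by split; apply: meet; [left | right].
have ib : (i < b < n - C)%N by lia.
have lin : (i < n)%N by lia.
have bn' : (b < n)%N by lia.
have [Sbx Sby] := Sxy b bn'; have [Six Siy] := Sxy i lin.
have ibn : (i < b < n)%N by lia.
have ne_ib : i != b by lia.
have Cin : (C <= i < n)%N by lia.
have bnC : (b < n - C)%N by lia.
exists (h i), (h b), (S i), (S b); split; split => //.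
- exact: hS.
- exact: hS.
- exact: hL.
- exact: SS.
have fi := is_side_push fK f'K f_isom (hS i lin).
have Sify : 2^-1 < (S i \o f') (f y) by rewrite /= fK.
have [//|bad] := disjoint_nested (hS b bn') fi dis Sbx (back i Cin) (forth b bnC) Sify.
have : S b y < - 2^-1 by apply: bad; rewrite /= /y fK; lra.
rewrite -/f -/y in Sby; lra.
Qed.

End Skewering.

(** * The curtain model *)

Section Model.
Context {R : realType} {X : metricType R}.
Hypothesis X_CAT0 : CAT0 X.
Implicit Types (x y : X).
Variable lambda : nat -> R.
Hypothesis lambda_weights : curtain_weights lambda.

Lemma L_dist_sym L x y : L_dist L x y = L_dist L y x.
Proof.
have sub u v : L_chain_cards L u v `<=` L_chain_cards L v u.
  move=> n [c [cL cs]]; exists c; split => // i.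
  by case: (cs i) => -[]; [right | left].
rewrite /L_dist eq_sym; have -> // : L_chain_cards L x y = L_chain_cards L y x.
by apply/seteqP; split; exact: sub.
Qed.

Lemma lambda_ge0 L : (0 < L)%N -> 0 <= lambda L.
Proof. by case: lambda_weights => h _ _ /h /andP[/ltW]. Qed.

Lemma nondecreasing_sum (F : nat -> R) : (forall L, (0 < L)%N -> 0 <= F L) ->
  nondecreasing_seq (fun n => \sum_(1 <= L < n) F L).
Proof.
move=> F0; apply/nondecreasing_seqP => -[|n]; first by rewrite !big_geq.
by rewrite [leRHS]big_nat_recr//= lerDl; exact: F0.
Qed.

Let Q : R := limn (fun n => \sum_(1 <= L < n) L%:R ^+ 2 * lambda L).

(** A bound on d_L that is linear in L suffices, since L is at most its square and
    the weights have a finite second moment. *)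
Lemma model_sum_le (A B : R) x y n : 0 <= A -> 0 <= B ->
  (forall L, (0 < L)%N -> L_dist L x y <= A * L%:R + B) ->
  \sum_(1 <= L < n) lambda L * L_dist L x y <= A * Q + B.
Proof.
move=> A0 B0 hAB; have [_ h1 h2] := lambda_weights.
apply: (@le_trans _ _ (A * (\sum_(1 <= L < n) L%:R ^+ 2 * lambda L) +
    B * \sum_(1 <= L < n) lambda L)).
  rewrite !big_distrr -big_split/= big_nat [leRHS]big_nat; apply: ler_sum => L.
  move=> /andP[L0 _]; have l0 := lambda_ge0 L0.
  have : lambda L * L_dist L x y <= lambda L * (A * L%:R + B).
    by rewrite ler_wpM2l// hAB.
  have L1 : 1 <= L%:R :> R by rewrite ler1n.
  have : A * lambda L * L%:R <= A * lambda L * L%:R ^+ 2.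
    by rewrite ler_wpM2l ?mulr_ge0// expr2 ler_peMl//; lra.
  lra.
apply: lerD; first rewrite ler_wpM2l//.
  apply: (nondecreasing_cvgn_le _ h2); apply: nondecreasing_sum => L L0.
  by rewrite mulr_ge0 ?sqr_ge0// lambda_ge0.
rewrite -[leRHS]mulr1 ler_wpM2l//.
have E := cvg_lim (@Rhausdorff R) h1; rewrite -E.
apply: nondecreasing_cvgn_le; first exact: (nondecreasing_sum lambda_ge0).
by apply/cvg_ex; exists 1.
Qed.

Lemma model_sum_nondecreasing x y :
  nondecreasing_seq (fun n => \sum_(1 <= L < n) lambda L * L_dist L x y).
Proof.
apply: nondecreasing_sum => L L0.
by rewrite mulr_ge0 ?lambda_ge0// L_dist_ge0.
Qed.

Lemma is_cvg_model_sum x y :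
  cvgn (fun n => \sum_(1 <= L < n) lambda L * L_dist L x y).
Proof.
apply: nondecreasing_is_cvgn; first exact: model_sum_nondecreasing.
exists (0 * Q + (1 + mdist x y)) => _ [n _ <-].
apply: model_sum_le => //; first by have := mdist_ge0 x y; lra.
by move=> L _; rewrite mul0r add0r; exact: L_dist_le_mdist.
Qed.

Lemma model_dist_le (A B : R) x y : 0 <= A -> 0 <= B ->
  (forall L, (0 < L)%N -> L_dist L x y <= A * L%:R + B) ->
  curtain_model_dist lambda x y <= A * Q + B.
Proof.
move=> A0 B0 hAB; apply: limr_le; first exact: is_cvg_model_sum.
by apply: nearW => n; exact: model_sum_le.
Qed.

Lemma model_dist_ge L x y : (0 < L)%N ->
  lambda L * L_dist L x y <= curtain_model_dist lambda x y.
Proof.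
move=> L0; have := nondecreasing_cvgn_le (@model_sum_nondecreasing x y)
  (@is_cvg_model_sum x y) L.+1.
apply: le_trans; rewrite big_nat_recr//= lerDr big_nat; apply: sumr_ge0 => i.
by move=> /andP[i0 _]; rewrite mulr_ge0 ?lambda_ge0// L_dist_ge0.
Qed.

Lemma model_dist_sym x y :
  curtain_model_dist lambda x y = curtain_model_dist lambda y x.
Proof.
rewrite /curtain_model_dist; congr (limn _); apply/funext => n.
by apply: eq_bigr => L _; rewrite L_dist_sym.
Qed.

Variables (g g' : X -> X).
Hypotheses (gK : cancel g g') (g'K : cancel g' g).
Hypothesis g_isom : forall x y, mdist (g x) (g y) = mdist x y.

Lemma model_dist_iter i x y :
  curtain_model_dist lambda (iter i g x) (iter i g y) =
  curtain_model_dist lambda x y.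
Proof.
rewrite /curtain_model_dist; congr (limn _); apply/funext => n.
apply: eq_bigr => L _.
by rewrite (L_dist_isom (can_iter gK i) (can_iter g'K i) (isom_iter g_isom i)).
Qed.

Lemma model_orbit_bounded (A B : R) x : 0 <= A -> 0 <= B ->
  (forall L n, (0 < L)%N -> L_dist L x (iter n g x) <= A * L%:R + B) ->
  metric_bounded (curtain_model_dist lambda) (cyclic_orbit g x).
Proof.
move=> A0 B0 hAB; exists (A * Q + B) => y z [n yn] [m zm].
(* all the points in play are in the forward orbit of w *)
pose w := iter (n + m) g' x.
have wx : x = iter (n + m) g w by rewrite (can_iter g'K).
have fwd v p : (p <= n + m)%N -> v = iter p g x \/ iter p g v = x ->
    exists i, v = iter i g w.
  move=> pnm [->|vx]; first by exists (p + (n + m))%N; rewrite iterD -wx.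
  exists (n + m - p)%N; apply: (can_inj (can_iter gK p)).
  by rewrite vx -iterD subnKC.
have [i ->] := fwd y n (leq_addr _ _) yn.
have [j ->] := fwd z m (leq_addl _ _) zm.
have key k l : (k <= l)%N ->
    curtain_model_dist lambda (iter k g w) (iter l g w) <= A * Q + B.
  move=> kl; rewrite -(subnKC kl) iterD model_dist_iter.
  rewrite -(model_dist_iter (n + m)) -wx -iterD addnC iterD -wx.
  by apply: model_dist_le => // L L0; exact: hAB.
by have [/key//|/ltnW/key] := leqP i j; rewrite model_dist_sym.
Qed.

Lemma skewers_translation_length L N x : (0 < L)%N ->
  skewers L (iter N g) (iter N g') x ->
  ~ is_translation_length (curtain_model_dist lambda) g 0.
Proof.
move=> L0 sk /(_ x) /cvgrPdist_lt.
have l0 : 0 < lambda L by case: lambda_weights => /(_ L L0) /andP[].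
have N0 : (0 < N)%N.
  rewrite lt0n; apply/eqP => E; move: sk => [h [k [S [T [_ [_ _ ]]]]]].
  by rewrite E /=; lra.
have NR : 0 < N%:R :> R by rewrite ltr0n.
move=> /(_ (lambda L / N%:R)); rewrite divr_gt0// => /(_ isT) [M _ hM].
have := hM (M.+1 * N)%N; rewrite /= sub0r normrN => /(_ _)/wrap[].
  by rewrite (leq_trans (leqnSn M))// leq_pmulr.
set y := iter _ g x.
have yE : y = iter M.+1 (iter N g) x by rewrite /y iterM.
have cards := skewers_L_chain X_CAT0 (can_iter gK N) (can_iter g'K N)
  (isom_iter g_isom N) M.+1 sk.
rewrite -yE in cards.
have xy : x != y.
  apply/eqP => E; have := L_chain_cards_mdist X_CAT0 cards.
  by rewrite -E mdistxx lern0.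
have := model_dist_ge x y L0.
have := ler_wpM2l (ltW l0) (L_dist_ge X_CAT0 xy cards) => h1 h2.
rewrite natrM invfM mulrA => h3.
have {h3} := le_lt_trans (ler_norm _) h3.
rewrite ltr_pM2r ?invr_gt0// ltr_pdivrMr ?ltr0n//; lra.
Qed.

End Model.

Theorem theorem1p5 (R : realType) (X : metricType R)
    (X_CAT0 : CAT0 X) (X_complete : complete_space X) (X_proper : proper_space X)
    (lambda : nat -> R) (lambda_weights : curtain_weights lambda)
    (g : X -> X) (g_isom : is_isometry (@mdist R X) g) :
  hyperbolic_parabolic (curtain_model_dist lambda : X -> X -> R) g ->
  strictly_parabolic (@mdist R X) g.
Proof.
move=> [D0 [x0 unbounded]]; have [[g' gK g'K] isom] := g_isom.
pose a n := mdist x0 (iter n g x0).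
have a_ge0 n : 0 <= a n by exact: mdist_ge0.
have a0 : a 0%N = 0 by rewrite /a mdistxx.
have [tau tau_ge0 [a_tau a_rate]] :=
  subadditive_rate a_ge0 a0 (orbit_aD isom x0).
have tau0 : tau = 0.
  apply/eqP; rewrite -[_ == _]negbK; apply/negP => tau_neq0.
  have tau_gt0 : 0 < tau by rewrite lt_def tau_neq0.
  have [A [B skew]] := exists_skewers X_CAT0 gK g'K isom tau_gt0 a_tau a_rate.
  apply: unbounded; apply: (model_orbit_bounded X_CAT0 lambda_weights gK g'K isom
    (A := A%:R) (B := 1 + B%:R)) => // L n L0.
  rewrite addrCA; apply: L_dist_le => [|m hm].
    by rewrite addr_ge0 ?mulr_ge0.
  rewrite -natrM -natrD ler_nat leqNgt; apply/negP => /ltnW big.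
  exact: (skewers_translation_length X_CAT0 lambda_weights gK g'K isom L0
    (skew L n m hm big)).
have trans0 : is_translation_length (@mdist R X) g 0.
  move=> x; apply/cvgrPdist_le => e e0.
  have [K hK] := a_rate (e / 2) (divr_gt0 e0 (ltr0n _ 2)).
  pose M := (Num.truncn (4 * mdist x x0 / e)).+1.
  exists (K + M.+1)%N => // n /= Kn.
  have n0 : 0 < n%:R :> R by rewrite ltr0n; lia.
  rewrite sub0r normrN normrM normfV !ger0_norm ?mdist_ge0// ler_pdivrMr//.
  have T1 := metric_triangle x x0 (iter n g x).
  have T2 := metric_triangle x0 (iter n g x0) (iter n g x).
  rewrite (isom_iter isom) (metric_sym x0 x) in T2.
  have := hK n (leq_trans (leq_addr _ _) Kn); rewrite tau0 add0r => an.
  have : 4 * mdist x x0 <= e * n%:R.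
    rewrite -ler_pdivrMl// mulrC; apply: (@le_trans _ _ M%:R).
      by apply/ltW; rewrite truncnS_gt.
    by rewrite ler_nat; lia.
  have := a_ge0 n; rewrite /a in an *; lra.
split => //; apply/seteqP; split => // x xMin.
have fix0 : mdist x (g x) = 0.
  have := cvg_unique (@Rhausdorff R) (xMin x) (trans0 x); exact.
have gx : g x = x by apply/esym/mdist_positivity.
apply: unbounded; apply: (model_orbit_bounded X_CAT0 lambda_weights gK g'K isom
  (A := 0) (B := 1 + 2 * mdist x0 x)) => // [|L n L0].
  by have := mdist_ge0 x0 x; lra.
rewrite mul0r add0r; apply: le_trans (L_dist_le_mdist X_CAT0 _ _ _) _.
have gnx : iter n g x = x by elim: n => //= n ->.
have T := metric_triangle x0 x (iter n g x0).
have : mdist x (iter n g x0) = mdist x x0 by rewrite -{1}gnx (isom_iter isom).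
rewrite (metric_sym x x0); lra.
Qed.
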